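(* Let $r\ge2$ be even and $\alpha=\alpha_{1,r}=-2/(r-1)$. Let $\eta=(\eta_1,\dots,\eta_m)$ and $\mu=(\mu_1,\dots,\mu_{N-m})$ be partitions (parts allowed to be zero) and let $\lambda=(\eta_1,\dots,\eta_m,\mu_1,\dots,\mu_{N-m})$ be their concatenation. Assume $\lambda$ is moderately $(1,r,N|m)$-admissible. Then the non-symmetric Jack polynomial $E_\lambda(x;\alpha_{1,r})$ is the unique polynomial $E$ satisfying (1) $E=x^\lambda+\sum_{\gamma\prec\lambda}c_{\lambda,\gamma}x^\gamma$ with $c_{\lambda,\gamma}\in\mathbb{C}$; (2) $\xi_iE=\bar\lambda_iE$ for all $1\le i\le N$, where $\xi_i$ and $\bar\lambda_i$ are taken at $\alpha=\alpha_{1,r}$.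
   Context: $x=(x_1,\dots,x_N)$; $K_{i,j}$ exchanges $x_i,x_j$. Compositions $\gamma\in\mathbb{Z}_{\ge0}^N$, $x^\gamma=\prod x_i^{\gamma_i}$, $\gamma^+$ decreasing rearrangement. Partitions of equal size compared by dominance. For compositions of equal degree, $\lambda\succ\gamma$ iff $\lambda\ne\gamma$ and either $\lambda^+>\gamma^+$, or $\lambda^+=\gamma^+$ and $\sum_{i\le k}\lambda_i\ge\sum_{i\le k}\gamma_i$ for all $k$. Cherednik operators $\xi_j=\alpha x_j\partial_{x_j}+\sum_{i<j}\frac{x_j}{x_j-x_i}(1-K_{i,j})+\sum_{i>j}\frac{x_i}{x_j-x_i}(1-K_{i,j})-(j-1)$; $\bar\lambda_j=\alpha\lambda_j-\#\{i<j:\lambda_i\ge\lambda_j\}-\#\{i>j:\lambda_i>\lambda_j\}$. For $\alpha$ formal, $E_\lambda(x;\alpha)$ is the unique polynomial $x^\lambda+\sum_{\gamma\prec\lambda}c_{\lambda,\gamma}x^\gamma$ (coefficients rational in $\alpha$) with $\xi_jE_\lambda=\bar\lambda_jE_\lambda$ for all $j$; under the hypotheses it has no pole at $\alpha_{1,r}$ and $E_\lambda(x;\alpha_{1,r})$ is its value there. For a composition $\lambda$ and $0\le m\le N$, $\varphi_m(\lambda)$ is the superpartition $\Lambda$ with $\Lambda^*=(\lambda_1,\dots,\lambda_N)^+$ and $\Lambda^\circledast=(\lambda_1+1,\dots,\lambda_m+1,\lambda_{m+1},\dots,\lambda_N)^+$. $\lambda$ is moderately $(1,r,N|m)$-admissible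 if $\Lambda=\varphi_m(\lambda)$ satisfies $\Lambda^\circledast_i-\Lambda^\circledast_{i+1}\ge r$ for all $1\le i\le N-1$. *)

(* Defs.v *)
From HB Require Import structures.
From mathcomp Require Import all_boot all_order all_fingroup all_algebra.
From mathcomp.real_closed Require Import complex.
From mathcomp Require Import reals.
From mathcomp.multinomials Require Import mpoly.

Set Implicit Arguments.
Unset Strict Implicit.
Unset Printing Implicit Defensive.

Import Order.TTheory GRing.Theory Num.Theory.

Local Open Scope ring_scope.

(* A composition with N parts is a multi-exponent lam : 'X_{1..N}; indices are
   shifted to start at 0, so that x_1, ..., x_N are 'X_0, ..., 'X_(N-1). *)

Definition decreasing (s : seq nat) : seq nat := sort geq s.

Definition psum_geq (N : nat) (s t : seq nat) : bool :=
  [forall k : 'I_N.+1, (sumn (take k t) <= sumn (take k s))%N].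

Definition dominates (N : nat) (s t : seq nat) : bool :=
  (sumn s == sumn t) && psum_geq N s t.

Definition comp_gt (N : nat) (lam gam : 'X_{1..N}) : bool :=
  let lamp := decreasing lam in
  let gamp := decreasing gam in
  [&& mdeg lam == mdeg gam, lam != gam &
      ((lamp != gamp) && dominates N lamp gamp)
      || ((lamp == gamp) && psum_geq N lam gam)].

Section Cherednik.
Variables (F : fieldType) (N : nat).
Implicit Types (a : F) (lam : 'X_{1..N}) (E : {mpoly F[N]}).

(* The summands of xi_j E are rational functions of x, so xi_j E is formed in
   the fraction field of F[x_1, ..., x_N].  With 0-based j, "j - 1" is j. *)
Definition cherednik a (j : 'I_N) E : {fraction {mpoly F[N]}} :=
  tofrac (a *: ('X_j * mderiv j E))
  + \sum_(i < N | (i < j)%N)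
      tofrac 'X_j / tofrac ('X_j - 'X_i) * tofrac (E - msym (tperm i j) E)
  + \sum_(i < N | (j < i)%N)
      tofrac 'X_i / tofrac ('X_j - 'X_i) * tofrac (E - msym (tperm i j) E)
  - tofrac (j%:R *: E).

Definition cherednik_eigenvalue a lam (j : 'I_N) : F :=
  a * (lam j)%:R
  - #|[set i : 'I_N | (i < j)%N && (lam j <= lam i)%N]|%:R
  - #|[set i : 'I_N | (j < i)%N && (lam j < lam i)%N]|%:R.

(* The index type 'X_{1..N < (mdeg lam).+1} contains every gam of the same
   degree as lam, hence every gam with comp_gt lam gam. *)
Definition triangular lam E : Prop :=
  exists c : 'X_{1..N} -> F,
    E = 'X_[lam]
        + \sum_(gam : 'X_{1..N < (mdeg lam).+1} | comp_gt lam gam)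
            c gam *: 'X_[gam].

Definition jack_conditions a lam E : Prop :=
  triangular lam E
  /\ forall j : 'I_N,
       cherednik a j E = tofrac (cherednik_eigenvalue a lam j *: E).

End Cherednik.

Section Specialization.
Variables (C : fieldType) (N : nat).

(* f has no pole at a, and its value there is v. *)
Definition value_at (f : {fraction {poly C}}) (a v : C) : Prop :=
  exists p q : {poly C},
    [/\ q.[a] != 0, f = tofrac p / tofrac q & v = p.[a] / q.[a]].

Definition generic_jack (lam : 'X_{1..N})
    (G : {mpoly {fraction {poly C}}[N]}) : Prop :=
  unique (jack_conditions (tofrac 'X) lam) G.

Definition jack_at (a : C) (lam : 'X_{1..N}) (E : {mpoly C[N]}) : Prop :=
  exists G : {mpoly {fraction {poly C}}[N]},
    generic_jack lam G
    /\ forall gam : 'X_{1..N}, value_at (mcoeff gam G) a (mcoeff gam E).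

End Specialization.

(* A superpartition is given by its pair of partitions (Lambda^*, Lambda^circledast),
   written in decreasing order and padded with zeros to N parts. *)
Record superpartition := SuperPartition {
  sp_star : seq nat;
  sp_circledast : seq nat
}.

Definition phi (N m : nat) (lam : 'X_{1..N}) : superpartition :=
  SuperPartition
    (decreasing lam)
    (decreasing [seq (lam i + (i < m))%N | i : 'I_N]).

Definition moderately_admissible (r N m : nat) (lam : 'X_{1..N}) : Prop :=
  let L := sp_circledast (phi m lam) in
  forall i : nat, (i.+1 < N)%N -> (nth 0%N L i.+1 + r <= nth 0%N L i)%N.

Definition concat_comp (m n : nat) (eta : m.-tuple nat) (mu : n.-tuple nat) :
    'X_{1..m + n} :=
  [multinom [tuple of eta ++ mu]].

Definition alpha1 (C : fieldType) (r : nat) : C := - 2%:R / (r%:R - 1).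

(* Main.v *)
(* The Cherednik operators are triangular with respect to the order on
   compositions and commute: writing xi_j as alpha x_j d_j + sum_i A_ji - const
   with A_ij = -A_ji = x_max(i,j) / (x_i - x_j) (1 - K_ij), commutation reduces to
   [A_12, A_13] + [A_12, A_23] + [A_13, A_23] = 0.  Hence, if every gamma below
   lambda is separated from lambda by the eigenvalue of some xi_j(gamma) at
   alpha = a, the product of the (xi_j(gamma) - gammabar_j(gamma)) over all such
   gamma, applied to x^lambda over C[alpha], is a joint eigenvector whose leading
   coefficient does not vanish at a; normalized, it is the generic Jack
   polynomial, and it specializes at a.  Triangularity and separation
   also give uniqueness.

   Separation at alpha = -2/(r-1): let a_i and b_i be the positions of the index
   i in lambda^+ and gamma^+ and s = r - 1, so that equal spectra mean
   2 lambda_i + s a_i = 2 gamma_i + s b_i.  By admissibility every pair i, j with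
   a_i < a_j and b_i > b_j satisfies b_i - b_j >= a_j - a_i, with equality only if
   a_j = a_i + 1.  A double counting forces equality for all such pairs, so
   |b_i - a_i| <= 1, and this difference is even because s is odd; thus a = b and
   lambda = gamma. *)

Require Import Defs.
From HB Require Import structures.
From mathcomp Require Import all_boot all_order all_fingroup all_algebra.
From mathcomp Require Import ring zify.
From mathcomp.real_closed Require Import complex.
From mathcomp Require Import reals.
From mathcomp.multinomials Require Import mpoly.

Set Implicit Arguments.
Unset Strict Implicit.
Unset Printing Implicit Defensive.

Import Order.TTheory GRing.Theory Num.Theory.

Local Open Scope ring_scope.

(** * Exchange operators on polynomials *)

Lemma exchange_disjoint_alg (D : comPzRingType)
    (d1 d2 m1 m2 E E' F F' f f1 f2 f12 : D) :
  d1 * E = m1 * (f - f1) -> d1 * E' = m1 * (f2 - f12) ->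
  d2 * F = m2 * (f - f2) -> d2 * F' = m2 * (f1 - f12) ->
  d1 * (m2 * (E - E')) = d2 * (m1 * (F - F')).
Proof.
move=> HE HE' HF HF'.
transitivity (m2 * (d1 * E - d1 * E')); first by ring.
transitivity (m1 * (d2 * F - d2 * F')); last by ring.
by rewrite HE HE' HF HF'; ring.
Qed.

Section Exchange.
Variables (R : idomainType) (N : nat).
Implicit Types (i j k l p q : 'I_N) (f g : {mpoly R[N]}) (h : 'X_{1..N}).

Local Notation mx := {mpoly R[N]}.

(** For p != q, the quotient of x_q (x^h - K_pq x^h) by x_q - x_p as a finite geometric sum. When
    h_p >= h_q the sign is reversed and the exponent shift starts at 1 instead of 0. *)
Definition exchange_mon p q h : mx :=
  if (h p < h q)%N
  then \sum_(t < h q - h p) 'X_[h + U_(p) *+ t - U_(q) *+ t]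
  else - \sum_(t < h p - h q) 'X_[h + U_(q) *+ t.+1 - U_(p) *+ t.+1].

Lemma msymU (s : 'S_N) k : msym s 'X_k = 'X_(s k) :> mx.
Proof.
rewrite msymX; congr 'X_[_]; apply/mnmP=> i.
by rewrite mnmE !mnm1E -(inj_eq (@perm_inj _ s)) permKV.
Qed.

(** Consecutive terms cancel. The bound on [d] keeps the truncated subtractions of exponents exact,
    since [h + U_(q)] has entry h_q + 1 at q. *)
Lemma exchange_mon_telescope p q h (d : nat) : p != q -> (d <= (h q).+1)%N ->
  ('X_q - 'X_p) * \sum_(t < d) 'X_[h + U_(p) *+ t - U_(q) *+ t]
  = 'X_[h + U_(q)] - 'X_[h + U_(q) + U_(p) *+ d - U_(q) *+ d] :> mx.
Proof.
move=> npq; elim: d => [_|d IH hd].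
  rewrite big_ord0 mulr0.
  rewrite (_ : (h + U_(q) + U_(p) *+ 0 - U_(q) *+ 0)%MM = (h + U_(q))%MM) ?subrr //.
  by apply/mnmP=> i; rewrite !(mnmE, mulmnE); lia.
rewrite big_ord_recr /= mulrDr IH ?(ltnW hd) // mulrBl -!mpolyXD.
set m1 := (h + U_(q) + U_(p) *+ d - _)%MM.
set m2 := (h + U_(q) + U_(p) *+ d.+1 - _)%MM.
have -> : (U_(q) + (h + U_(p) *+ d - U_(q) *+ d))%MM = m1.
  apply/mnmP=> i; rewrite !(mnmE, mulmnE).
  by case: (eqVneq q i) => [<-|] /=; case: (eqVneq p _) => [E|] /=; lia.
have -> : (U_(p) + (h + U_(p) *+ d - U_(q) *+ d))%MM = m2.
  apply/mnmP=> i; rewrite !(mnmE, mulmnE).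
  by case: (eqVneq q i) => [<-|] /=; case: (eqVneq p _) => [E|] /=; lia.
by ring.
Qed.

Lemma exchange_monP p q h : p != q ->
  ('X_q - 'X_p) * exchange_mon p q h
  = 'X_q * ('X_[h] - msym (tperm p q) 'X_[h]) :> mx.
Proof.
move=> npq; rewrite /exchange_mon msymX tpermV mulrBr -!mpolyXD.
case: ltnP => hpq.
  rewrite exchange_mon_telescope ?leqW ?leq_subr //.
  congr ('X_[_] - 'X_[_]); apply/mnmP=> i;
  rewrite !(mnmE, mulmnE); first by lia.
  case: tpermP => [->|->|/eqP ip /eqP iq].
  - by rewrite eqxx (eq_sym q) (negbTE npq) /=; lia.
  - by rewrite eqxx (negbTE npq) /=; lia.
  - by rewrite (eq_sym p) (eq_sym q) (negbTE ip) (negbTE iq) /=; lia.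
rewrite mulrN.
(* Shifting h by e_q - e_p absorbs the offset in [t.+1], so the telescoping sum applies with p and q
   exchanged. *)
have -> : \sum_(t < h p - h q) 'X_[h + U_(q) *+ t.+1 - U_(p) *+ t.+1]
  = \sum_(t < h p - h q) 'X_[(h + U_(q) - U_(p)) + U_(q) *+ t - U_(p) *+ t] :> mx.
  apply: eq_bigr => -[t ht] _; congr 'X_[_]; apply/mnmP=> i /=.
  rewrite !(mnmE, mulmnE).
  by case: (eqVneq p i) => [<-|] /=; rewrite 1?(eq_sym q) ?(negbTE npq) /=; lia.
(* If the sum is empty, h_p = h_q and the swap fixes h. Otherwise h_p > 0, so subtracting e_p from h
   + e_q is not truncated. *)
have [e0|e0] := posnP (h p - h q).
  rewrite e0 big_ord0 mulr0 oppr0; apply/esym/eqP; rewrite subr_eq0; apply/eqP.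
  congr 'X_[_].
  by apply/mnmP=> i; rewrite !mnmE; case: tpermP => [->|->|] //; lia.
rewrite -opprB mulNr opprK exchange_mon_telescope 1?eq_sym //; last first.
  by rewrite !mnmE (eq_sym q) (negbTE npq) eqxx /=; lia.
congr ('X_[_] - 'X_[_]); apply/mnmP=> i; rewrite !(mnmE, mulmnE).
  by case: (eqVneq p i) => [<-|] /=; rewrite 1?(eq_sym q) ?(negbTE npq) /=; lia.
case: tpermP => [->|->|/eqP ip /eqP iq].
- rewrite eqxx (eq_sym q) (negbTE npq) /=. lia.
- by rewrite eqxx (negbTE npq) /=; lia.
- by rewrite (eq_sym p) (eq_sym q) (negbTE ip) (negbTE iq) /=; lia.
Qed.

Definition ordmax_of i j : 'I_N := if (i < j)%N then j else i.

Lemma ordmax_ofC i j : ordmax_of i j = ordmax_of j i.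
Proof. by rewrite /ordmax_of; case: ltngtP => // /val_inj. Qed.

(* [exchange i j] is x_max(i,j) / (x_i - x_j) (1 - K_ij). *)
Definition exchange i j f : mx :=
  if (i < j)%N then - \sum_(h <- msupp f) f@_h *: exchange_mon i j h
  else if (j < i)%N then \sum_(h <- msupp f) f@_h *: exchange_mon j i h
  else 0.

Lemma exchangeP i j f :
  ('X_i - 'X_j) * exchange i j f
  = 'X_(ordmax_of i j) * (f - msym (tperm i j) f).
Proof.
have E p q : p != q -> ('X_q - 'X_p) * (\sum_(h <- msupp f) f@_h *: exchange_mon p q h)
  = 'X_q * (f - msym (tperm p q) f).
  move=> npq; have -> : f - msym (tperm p q) f
    = \sum_(h <- msupp f) f@_h *: ('X_[h] - msym (tperm p q) 'X_[h]).
    rewrite {1 2}(mpolyE f) (raddf_sum (msym (tperm p q))) -sumrB.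
    by apply: eq_bigr => h _; rewrite /= msymZ scalerBr.
  by rewrite !mulr_sumr; apply: eq_bigr => h _; rewrite -!scalerAr exchange_monP.
rewrite /exchange /ordmax_of; case: ltngtP => ij.
- by rewrite mulrN -mulNr opprB E // neq_ltn ij.
- by rewrite tpermC E // neq_ltn ij.
- by move/val_inj: ij => ->; rewrite tperm1 msym1m !subrr !mulr0.
Qed.

Lemma mpolyXB_neq0 i j : i != j -> 'X_i - 'X_j != 0 :> mx.
Proof.
move=> nij; apply: contra_neq (oner_neq0 R) => /(congr1 (mcoeff U_(i)%MM)).
by rewrite mcoeffB !mcoeffXU eqxx eq_sym (negbTE nij) subr0 mcoeff0.
Qed.

(** The factor x_i - x_j can be cancelled, so [exchangeP] determines the operator. Many identities
    below are proved by checking this division-free equation, without expanding into monomials. *)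
Lemma exchange_unique i j f g : i != j ->
  ('X_i - 'X_j) * g = 'X_(ordmax_of i j) * (f - msym (tperm i j) f) ->
  exchange i j f = g.
Proof.
by move=> nij E; apply: (mulfI (mpolyXB_neq0 nij)); rewrite exchangeP.
Qed.

Lemma exchangeii i f : exchange i i f = 0.
Proof. by rewrite /exchange ltnn. Qed.

Lemma exchange_is_linear i j : linear (exchange i j).
Proof.
move=> c f g; have [->|nij] := eqVneq i j; first by rewrite !exchangeii scaler0 addr0.
apply: exchange_unique => //.
rewrite mulrDr -scalerAr !exchangeP scalerAr -mulrDr msymD msymZ.
by congr (_ * _); rewrite scalerBr opprD addrACA.
Qed.

HB.instance Definition _ i j :=
  GRing.isLinear.Build R mx mx _ (exchange i j) (exchange_is_linear i j).

Lemma exchangeC i j f : exchange i j f = - exchange j i f.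
Proof.
have [->|nij] := eqVneq i j; first by rewrite !exchangeii oppr0.
by apply: exchange_unique => //; rewrite mulrN -mulNr opprB exchangeP ordmax_ofC tpermC.
Qed.

Definition euler i f : mx := 'X_i * f^`M(i).

Lemma euler_is_linear i : linear (euler i).
Proof. by move=> c f g; rewrite /euler linearP mulrDr -scalerAr. Qed.

HB.instance Definition _ i :=
  GRing.isLinear.Build R mx mx _ (euler i) (euler_is_linear i).

Lemma eulerX i h : euler i 'X_[h] = (h i)%:R *: 'X_[h].
Proof.
rewrite /euler mderivX -scalerAr -mpolyXD.
have [->|hi] := posnP (h i); first by rewrite !scale0r.
congr (_ *: 'X_[_]); apply/mnmP=> k; rewrite !mnmE.
by case: (eqVneq i k) => [<-|] /=; lia.
Qed.

Lemma mcoeff_euler i f h : (euler i f)@_h = (h i)%:R * f@_h.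
Proof.
rewrite [in LHS](mpolyE f) [in RHS](mpolyE f) !raddf_sum mulr_sumr /=.
apply: eq_bigr => k _.
rewrite linearZ /= eulerX !mcoeffZ mcoeffX.
by case: eqP => [->|]; rewrite ?mulr0 ?mulr1 // mulrC.
Qed.

Lemma eulerM i f g : euler i (f * g) = euler i f * g + f * euler i g.
Proof. by rewrite /euler mderivM; ring. Qed.

Lemma eulerU i k : euler i 'X_k = (i == k)%:R *: 'X_k.
Proof. by rewrite eulerX mnm1E eq_sym. Qed.

Lemma euler_msym i (s : 'S_N) f : euler (s i) (msym s f) = msym s (euler i f).
Proof.
by apply/mpolyP=> h; rewrite mcoeff_euler !mcoeff_sym mcoeff_euler mnmE.
Qed.

Lemma eulerC i j f : euler i (euler j f) = euler j (euler i f).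
Proof. by apply/mpolyP=> h; rewrite !mcoeff_euler mulrCA. Qed.

(** The derivation x_k d_k kills x_i and x_j and commutes with K_ij, so applying it to [exchangeP]
    gives the defining equation for the image of f. *)
Lemma euler_exchange i j k f : k != i -> k != j ->
  euler k (exchange i j f) = exchange i j (euler k f).
Proof.
move=> nki nkj; have [->|nij] := eqVneq i j; first by rewrite !exchangeii raddf0.
apply/esym/exchange_unique => //.
have e0 p : k != p -> euler k 'X_p = 0.
  by move=> nkp; rewrite eulerU (negbTE nkp) scale0r.
have := congr1 (euler k) (exchangeP i j f).
rewrite !eulerM !raddfB /= !e0 // ?subrr ?mul0r ?add0r; last first.
  by rewrite /ordmax_of; case: ifP.
by rewrite -euler_msym tpermD 1?eq_sym.
Qed.

(** The factor x_max / (x_i - x_j) is homogeneous of degree 0 in x_i, x_j, hence killed by x_i d_i +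
    x_j d_j, and this operator commutes with K_ij. *)
Lemma euler2_exchange i j f :
  euler i (exchange i j f) + euler j (exchange i j f)
  = exchange i j (euler i f) + exchange i j (euler j f).
Proof.
have [->|nij] := eqVneq i j; first by rewrite !exchangeii raddf0.
rewrite -raddfD /=; apply/esym/exchange_unique => //.
have D1 := congr1 (euler i) (exchangeP i j f).
have D2 := congr1 (euler j) (exchangeP i j f).
have s1 : euler i (msym (tperm i j) f) = msym (tperm i j) (euler j f).
  by rewrite -euler_msym tpermR.
have s2 : euler j (msym (tperm i j) f) = msym (tperm i j) (euler i f).
  by rewrite -euler_msym tpermL.
move: D1 D2; rewrite !eulerM !raddfB /= s1 s2 !eulerU !eqxx (eq_sym j) (negbTE nij).
rewrite raddfD /= !scale0r !scale1r subr0 sub0r.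
have EP := exchangeP i j f; move: EP; rewrite /ordmax_of; case: ltnP => _ EP.
all: rewrite ?eqxx ?(eq_sym j) ?(negbTE nij) ?scale0r ?scale1r => D1 D2.
(* Adding the two derived identities leaves an extra (x_i - x_j) A_ij f on the left, from
   differentiating the denominator, and an extra x_max (f - K_ij f) on the right; these agree by
   [EP]. *)
all: apply: (addrI (('X_i - 'X_j) * exchange i j f)); rewrite {2}EP.
all: transitivity (('X_i * exchange i j f + ('X_i - 'X_j) * euler i (exchange i j f))
   + (- 'X_j * exchange i j f + ('X_i - 'X_j) * euler j (exchange i j f))); first by ring.
all: by rewrite D1 D2; ring.
Qed.

Lemma msym_exchangeP (s : 'S_N) i j f :
  ('X_(s i) - 'X_(s j)) * msym s (exchange i j f)
  = 'X_(s (ordmax_of i j)) * (msym s f - msym s (msym (tperm i j) f)).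
Proof.
by have := congr1 (msym s) (exchangeP i j f); rewrite !msymM !msymB !msymU.
Qed.

Lemma msymC (s t : 'S_N) f : (t * s = s * t)%g ->
  msym s (msym t f) = msym t (msym s f).
Proof. by rewrite -!msymMm => ->. Qed.

(** The two transpositions commute and each fixes the variables in the prefactor of the other, so
    both sides agree once the two denominators are cleared. *)
Lemma exchange_disjoint i j k l f :
  i != j -> k != l -> i != k -> i != l -> j != k -> j != l ->
  exchange i j (exchange k l f) = exchange k l (exchange i j f).
Proof.
move=> nij nkl nik nil njk njl.
have fixij : forall p, p != i -> p != j -> tperm i j p = p.
  by move=> p ni nj; rewrite tpermD // eq_sym.
have fixkl : forall p, p != k -> p != l -> tperm k l p = p.
  by move=> p nk nl; rewrite tpermD // eq_sym.
apply: exchange_unique => //; apply: (mulfI (mpolyXB_neq0 nkl)).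
have E1 := exchangeP i j f; have E2 := exchangeP k l f.
have E3 := msym_exchangeP (tperm i j) k l f.
have E4 := msym_exchangeP (tperm k l) i j f.
rewrite msymC in E4; last first.
  by rewrite [LHS]conjgC tpermJ !fixkl.
have mij : tperm i j (ordmax_of k l) = ordmax_of k l.
  by rewrite /ordmax_of; case: ifP => _; rewrite fixij // eq_sym.
have mkl : tperm k l (ordmax_of i j) = ordmax_of i j.
  by rewrite /ordmax_of; case: ifP => _; rewrite fixkl.
move: E3 E4; rewrite mij mkl (fixij k) 1?eq_sym // (fixij l) 1?eq_sym // !fixkl //.
move=> E3 E4.
by rewrite [LHS]mulrCA exchangeP; apply: exchange_disjoint_alg E1 E4 E2 E3.
Qed.

End Exchange.

(* With three indices 1 < 2 < 3 and A_ij = [exchange i j]: p_ij is A_ij f, the r's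
   are the images of the p's under transpositions, the q's are the products
   A A f, and u, v are the images of f under the two 3-cycles. *)
Lemma yang_baxter_field (K : fieldType) (x y z f f12 f13 f23 u v
    p12 p13 p23 r1 r2 r3 r4 r5 r6 q1 q2 q3 q4 q5 q6 : K) :
  x != y -> x != z -> y != z ->
  (x - y) * p12 = y * (f - f12) ->
  (x - z) * p13 = z * (f - f13) ->
  (y - z) * p23 = z * (f - f23) ->
  (y - z) * r1 = z * (f12 - u) ->
  (z - y) * r2 = y * (f13 - v) ->
  (x - z) * r3 = z * (f12 - v) ->
  (x - z) * r4 = z * (f23 - u) ->
  (y - x) * r5 = x * (f13 - u) ->
  (x - y) * r6 = y * (f23 - v) ->
  (x - y) * q1 = y * (p13 - r1) ->
  (x - z) * q2 = z * (p12 - r2) ->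
  (x - y) * q3 = y * (p23 - r3) ->
  (y - z) * q4 = z * (p12 - r4) ->
  (x - z) * q5 = z * (p23 - r5) ->
  (y - z) * q6 = z * (p13 - r6) ->
  q1 - q2 + q3 - q4 + q5 - q6 = 0.
Proof.
move=> nxy nxz nyz.
have E (d w c : K) : d != 0 -> d * w = c -> w = c / d.
  by move=> d0 <-; rewrite mulrAC mulfV // mul1r.
have dxy : x - y != 0 by rewrite subr_eq0.
have dxz : x - z != 0 by rewrite subr_eq0.
have dyz : y - z != 0 by rewrite subr_eq0.
have dzy : z - y != 0 by rewrite subr_eq0 eq_sym.
have dyx : y - x != 0 by rewrite subr_eq0 eq_sym.
move=> /(E _ _ _ dxy)-> /(E _ _ _ dxz)-> /(E _ _ _ dyz)->.
move=> /(E _ _ _ dyz)-> /(E _ _ _ dzy)-> /(E _ _ _ dxz)->.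
move=> /(E _ _ _ dxz)-> /(E _ _ _ dyx)-> /(E _ _ _ dxy)->.
move=> /(E _ _ _ dxy)-> /(E _ _ _ dxz)-> /(E _ _ _ dxy)->.
move=> /(E _ _ _ dyz)-> /(E _ _ _ dxz)-> /(E _ _ _ dyz)->.
by field; rewrite dxy dxz dyz dzy dyx.
Qed.

(** All relations are division-free, so they pass to the fraction field; the conclusion comes back
    because the embedding is injective. *)
Lemma yang_baxter (D : idomainType) (x y z f f12 f13 f23 u v
    p12 p13 p23 r1 r2 r3 r4 r5 r6 q1 q2 q3 q4 q5 q6 : D) :
  x != y -> x != z -> y != z ->
  (x - y) * p12 = y * (f - f12) ->
  (x - z) * p13 = z * (f - f13) ->
  (y - z) * p23 = z * (f - f23) ->
  (y - z) * r1 = z * (f12 - u) ->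
  (z - y) * r2 = y * (f13 - v) ->
  (x - z) * r3 = z * (f12 - v) ->
  (x - z) * r4 = z * (f23 - u) ->
  (y - x) * r5 = x * (f13 - u) ->
  (x - y) * r6 = y * (f23 - v) ->
  (x - y) * q1 = y * (p13 - r1) ->
  (x - z) * q2 = z * (p12 - r2) ->
  (x - y) * q3 = y * (p23 - r3) ->
  (y - z) * q4 = z * (p12 - r4) ->
  (x - z) * q5 = z * (p23 - r5) ->
  (y - z) * q6 = z * (p13 - r6) ->
  q1 - q2 + q3 - q4 + q5 - q6 = 0.
Proof.
have T (a b c d e g : D) : (a - b) * c = d * (e - g) ->
  (tofrac a - tofrac b) * tofrac c = tofrac d * (tofrac e - tofrac g).
  by move=> H; rewrite -!tofracB -!tofracM H.
rewrite -(tofrac_eq x y) -(tofrac_eq x z) -(tofrac_eq y z) => nxy nxz nyz.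
move=> /T H1 /T H2 /T H3 /T H4 /T H5 /T H6 /T H7 /T H8
  /T H9 /T H10 /T H11 /T H12 /T H13 /T H14 /T H15.
apply/eqP; rewrite -tofrac_eq0 !(tofracB, tofracD); apply/eqP.
exact: (yang_baxter_field nxy nxz nyz H1 H2 H3 H4 H5 H6 H7 H8 H9 H10 H11 H12 H13 H14 H15).
Qed.

(** * The three-index relation between exchange operators *)

Section ExchangeJacobi.
Variables (R : idomainType) (N : nat).
Implicit Types (i j k l : 'I_N) (f g : {mpoly R[N]}) (h : 'X_{1..N}).

Local Notation mx := {mpoly R[N]}.
Local Notation A := (@exchange R N).

Definition exchange_jacobi i j l f : mx :=
  A i j (A i l f) - A i l (A i j f) + A i j (A j l f) - A j l (A i j f)
  + A i l (A j l f) - A j l (A i l f).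

Lemma exchange_jacobi_sorted i j l f : (i < j < l)%N -> exchange_jacobi i j l f = 0.
Proof.
case/andP=> ij jl; have il := ltn_trans ij jl.
have nij : i != j by rewrite neq_ltn ij.
have njl : j != l by rewrite neq_ltn jl.
have nil : i != l by rewrite neq_ltn il.
have mE (p q : 'I_N) : (p < q)%N -> ordmax_of p q = q by rewrite /ordmax_of => ->.
have nX (p q : 'I_N) : p != q -> 'X_p != 'X_q :> mx.
  by move=> npq; rewrite -subr_eq0 mpolyXB_neq0.
have P := @exchangeP R N; have S := @msym_exchangeP R N.
have t12l : tperm i j l = l by rewrite tpermD.
have t13j : tperm i l j = j by rewrite tpermD // eq_sym.
have t23i : tperm j l i = i by rewrite tpermD // eq_sym.
(* The six products of two distinct transpositions on i, j, l are only two 3-cycles, so [u] and [v]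
   account for every twofold image of [f]. *)
pose u := msym (tperm i j) (msym (tperm i l) f).
pose v := msym (tperm i l) (msym (tperm i j) f).
have e1 : (tperm i l * tperm i j = tperm i j * tperm j l)%g.
  by rewrite [LHS]conjgC tpermJ tpermL t12l.
have e2 : (tperm j l * tperm i l = tperm i l * tperm i j)%g.
  by rewrite [LHS]conjgC tpermJ t13j tpermR [tperm j i]tpermC.
have e3 : (tperm j l * tperm i j = tperm i j * tperm i l)%g.
  by rewrite [LHS]conjgC tpermJ tpermR t12l.
have e4 : (tperm i j * tperm i l = tperm i l * tperm j l)%g.
  by rewrite [LHS]conjgC tpermJ tpermL t13j [tperm l j]tpermC.
have u1 : msym (tperm j l) (msym (tperm i j) f) = u by rewrite /u -!msymMm e1.
have u2 : msym (tperm i l) (msym (tperm j l) f) = u by rewrite /u -!msymMm e2.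
have v1 : msym (tperm i j) (msym (tperm j l) f) = v by rewrite /v -!msymMm e3.
have v2 : msym (tperm j l) (msym (tperm i l) f) = v by rewrite /v -!msymMm e4.
have H1 := P i j f; have H2 := P i l f; have H3 := P j l f.
have H4 := S (tperm i j) i l f.
have H5 := S (tperm i l) i j f.
have H6 := S (tperm i j) j l f.
have H7 := S (tperm j l) i j f.
have H8 := S (tperm i l) j l f.
have H9 := S (tperm j l) i l f.
have Q1 := P i j (A i l f); have Q2 := P i l (A i j f).
have Q3 := P i j (A j l f); have Q4 := P j l (A i j f).
have Q5 := P i l (A j l f); have Q6 := P j l (A i l f).
move: H1 H2 H3 H4 H5 H6 H7 H8 H9 Q1 Q2 Q3 Q4 Q5 Q6.
rewrite !mE // !tpermL !tpermR t12l t13j t23i -/u -/v u1 u2 v1 v2.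
exact: yang_baxter (nX _ _ nij) (nX _ _ nil) (nX _ _ njl).
Qed.

(** The sign changes under the two adjacent swaps of indices extend the vanishing from sorted
    triples to all triples of distinct indices. *)
Lemma exchange_jacobi_swap12 i j l f :
  exchange_jacobi j i l f = - exchange_jacobi i j l f.
Proof.
rewrite /exchange_jacobi !(exchangeC j i) !raddfN /=.
move: (A i j _) (A i l _) (A j l _) => *; ring.
Qed.
Lemma exchange_jacobi_swap23 i j l f :
  exchange_jacobi i l j f = - exchange_jacobi i j l f.
Proof.
rewrite /exchange_jacobi !(exchangeC l j) !raddfN /=.
by rewrite !opprD !opprK [LHS](AC (1*1*1*1*1*1) (2*1*5*6*3*4)).
Qed.

Lemma exchange_jacobi0 i j l f : i != j -> i != l -> j != l ->
  exchange_jacobi i j l f = 0.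
Proof.
have W i' j' l' : (i' < j')%N -> (i' < l')%N -> j' != l' ->
    exchange_jacobi i' j' l' f = 0.
  move=> ij il; rewrite neq_ltn => /orP[] jl.
    by apply: exchange_jacobi_sorted; rewrite ij.
  by rewrite exchange_jacobi_swap23 exchange_jacobi_sorted ?il ?oppr0.
have V i' j' l' : (i' < j')%N -> i' != l' -> j' != l' ->
    exchange_jacobi i' j' l' f = 0.
  move=> ij; rewrite neq_ltn => /orP[] il jl; first exact: W.
  rewrite exchange_jacobi_swap23 exchange_jacobi_swap12 opprK W //.
    exact: ltn_trans il ij.
  by rewrite neq_ltn ij.
move=> + nil njl; rewrite neq_ltn => /orP[] ij; first exact: V.
by rewrite exchange_jacobi_swap12 V ?oppr0.
Qed.

End ExchangeJacobi.

(** * Commutation of the Cherednik operators *)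

Section CherednikOp.
Variables (R : idomainType) (N : nat).
Implicit Types (i j k l : 'I_N) (f g : {mpoly R[N]}) (h : 'X_{1..N}).

Local Notation mx := {mpoly R[N]}.
Local Notation A := (@exchange R N).

Variable a : R.

(** The common form x_max / (x_j - x_i) merges the two sums of the Cherednik operator. The scalar
    term is left out, as it does not affect commutators. *)
Definition cherednik_main j f : mx :=
  a *: euler j f + \sum_(i | i != j) exchange j i f.

Lemma cherednik_main_is_linear j : linear (cherednik_main j).
Proof.
move=> c f g; rewrite /cherednik_main (linearP (euler j)).
rewrite (eq_bigr (fun i => c *: exchange j i f + exchange j i g)); last first.
  by move=> i _; rewrite (linearP (exchange j i)).
rewrite big_split -scaler_sumr /= !scalerDr.
by rewrite !scalerA [a * c]mulrC !addrA [LHS](AC (1*1*1*1) (1*3*2*4)).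
Qed.

HB.instance Definition _ j :=
  GRing.isLinear.Build R mx mx _ (cherednik_main j) (cherednik_main_is_linear j).

(** [P k] collects the exchanges of k with a third index. In the commutator of [P i] and [P j],
    terms with two different third indices cancel by [exchange_disjoint]; what remains for each
    third index l is [exchange_jacobi i j l f]. *)
Lemma commutator_sum_exchange i j f : i != j ->
  let P k g := \sum_(l | (l != i) && (l != j)) A k l g in
  A i j (P j f) - P j (A i j f) + A i j (P i f) - P i (A i j f)
  + P i (P j f) - P j (P i f) = 0.
Proof.
move=> nij P; rewrite -[LHS]addrA.
have -> : P i (P j f) - P j (P i f)
    = \sum_(l | (l != i) && (l != j)) (A i l (A j l f) - A j l (A i l f)).
  have -> : P j (P i f) = \sum_(k | (k != i) && (k != j))
      \sum_(l | (l != i) && (l != j)) A j l (A i k f).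
    by rewrite exchange_big; apply: eq_bigr => l _; rewrite raddf_sum.
  rewrite -sumrB; apply: eq_bigr => k /andP[ki kj].
  rewrite raddf_sum -sumrB (bigD1 k) ?ki ?kj //= big1 ?addr0 // => l.
  case/andP=> /andP[li lj] lk; apply/eqP; rewrite subr_eq0; apply/eqP.
  by apply: exchange_disjoint => //; rewrite eq_sym.
rewrite /P !raddf_sum -!big_split big1 //= => l /andP[li lj].
rewrite eq_sym in li; rewrite eq_sym in lj.
transitivity (exchange_jacobi i j l f); last exact: exchange_jacobi0.
by rewrite /exchange_jacobi !addrA [LHS](AC (1*1*1*1*1*1) (3*4*1*2*5*6)).
Qed.

(** Each variable stands for a word of operators applied to f, with [i], [j] for the Euler
    operators, [A] for the exchange of i and j, and [Pi], [Pj] for the sums over third indices: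
    [iPj] is euler i after P j. The scalar becomes a ring element [c], so [ring] can settle the
    expansion. *)
Lemma cherednik_main_comm_alg (D : comPzRingType)
    (c ij ji iA jA Ai Aj iPj Pji jPi Pij AA APj PjA APi PiA PiPj PjPi : D) :
  ij = ji -> iA + jA = Ai + Aj -> iPj = Pji -> jPi = Pij ->
  APj - PjA + APi - PiA + PiPj - PjPi = 0 ->
  c * (c * ij - iA + iPj) + (c * Aj - AA + APj) + (c * Pij - PiA + PiPj)
  = c * (c * ji + jA + jPi) - (c * Ai + AA + APi) + (c * Pji + PjA + PjPi).
Proof.
move=> -> E2 -> -> E5; apply/eqP; rewrite -subr_eq0; apply/eqP.
transitivity (c * ((Ai + Aj) - (iA + jA)) + (APj - PjA + APi - PiA + PiPj - PjPi)).
  by ring.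
by rewrite E2 E5 subrr mulr0 addr0.
Qed.

Lemma cherednik_mainC i j f :
  cherednik_main i (cherednik_main j f) = cherednik_main j (cherednik_main i f).
Proof.
have [->//|nij] := eqVneq i j.
pose P k g : mx := \sum_(l | (l != i) && (l != j)) A k l g.
have PD k g g' : P k (g + g') = P k g + P k g'.
  by rewrite -big_split; apply: eq_bigr => l _; rewrite /= raddfD.
have PN k g : P k (- g) = - P k g.
  by rewrite -sumrN; apply: eq_bigr => l _; rewrite /= raddfN.
have PZ k c g : P k (c *: g) = c *: P k g.
  by rewrite scaler_sumr; apply: eq_bigr => l _; rewrite /= linearZ.
have Ti g : cherednik_main i g = a *: euler i g + A i j g + P i g.
  rewrite /cherednik_main (bigD1 j) 1?eq_sym //= addrA.
  by congr (_ + _); apply: eq_bigl => l.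
have Tj g : cherednik_main j g = a *: euler j g - A i j g + P j g.
  rewrite /cherednik_main (bigD1 i) //= addrA exchangeC.
  by congr (_ + _); apply: eq_bigl => l; rewrite andbC.
rewrite (Tj f) (Ti f) (Ti (_ + _)) (Tj (_ + _)).
have EZ k c g : euler k (c *: g) = c *: euler k g by rewrite linearZ.
have AZ k l c g : A k l (c *: g) = c *: A k l g by rewrite linearZ.
rewrite !(raddfD (euler _), raddfN (euler _)) /= !EZ.
rewrite !(raddfD (exchange _ _), raddfN (exchange _ _)) /= !AZ.
rewrite !(PD, PN, PZ) -!mul_mpolyC.
have E1 := eulerC i j f; have E2 := euler2_exchange i j f.
have E3 : euler i (P j f) = P j (euler i f).
  rewrite raddf_sum; apply: eq_bigr => l /andP[li lj].
  by apply: euler_exchange => //; rewrite eq_sym.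
have E4 : euler j (P i f) = P i (euler j f).
  rewrite raddf_sum; apply: eq_bigr => l /andP[li lj].
  by apply: euler_exchange; rewrite eq_sym.
have E5 : A i j (P j f) - P j (A i j f) + A i j (P i f) - P i (A i j f)
  + P i (P j f) - P j (P i f) = 0 by exact: commutator_sum_exchange.
exact: (cherednik_main_comm_alg a%:MP_[N] (A i j (A i j f)) E1 E2 E3 E4 E5).
Qed.

(* The operator xi_(j+1) of the paper. *)
Definition cherednik_op j f : mx := cherednik_main j f - j%:R *: f.

Lemma cherednik_op_is_linear j : linear (cherednik_op j).
Proof.
move=> c f g; rewrite /cherednik_op (linearP (cherednik_main j)) /=.
move: (cherednik_main j f) (cherednik_main j g) => Mf Mg.
rewrite scalerBr scalerDr !scalerA [j%:R * c]mulrC opprD !addrA.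
by rewrite [LHS](AC (1*1*1*1) (1*3*2*4)).
Qed.

HB.instance Definition _ j :=
  GRing.isLinear.Build R mx mx _ (cherednik_op j) (cherednik_op_is_linear j).

Lemma shift_comm (F G : {linear mx -> mx}) (c d : R) f :
  F (G f) = G (F f) ->
  F (G f - d *: f) - c *: (G f - d *: f) = G (F f - c *: f) - d *: (F f - c *: f).
Proof.
move=> H; have FB : F (G f - d *: f) = F (G f) - d *: F f.
  by rewrite (raddfB F) /=; congr (_ - _); rewrite linearZ.
have GB : G (F f - c *: f) = G (F f) - c *: G f.
  by rewrite (raddfB G) /=; congr (_ - _); rewrite linearZ.
rewrite FB GB H; move: (G (F f)) (F f) (G f) => u v w.
rewrite !scalerBr !opprB !scalerA [d * c]mulrC !addrA.
by rewrite [LHS](AC (1*1*1*1) (1*4*3*2)).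
Qed.

Lemma cherednik_opC i j f :
  cherednik_op i (cherednik_op j f) = cherednik_op j (cherednik_op i f).
Proof. by apply: shift_comm; apply: cherednik_mainC. Qed.

Lemma cherednik_op_shiftC i j (c d : R) f :
  cherednik_op i (cherednik_op j f - d *: f) - c *: (cherednik_op j f - d *: f)
  = cherednik_op j (cherednik_op i f - c *: f) - d *: (cherednik_op i f - c *: f).
Proof. by apply: shift_comm; apply: cherednik_opC. Qed.

End CherednikOp.

(** * Dominance through excess sums *)

Section Dominance.
Implicit Types (s t : seq nat).

(* The sum of the k largest parts is the minimum over c of
   [k * c + \sum_x (x - c)] (truncated differences), which reduces dominance to
   comparing these excess sums. *)
Lemma sumn_take_le_excess s (k c : nat) : 
  (sumn (take k s) <= k * c + \sum_(x <- s) (x - c))%N.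
Proof.
elim: s k => [|x s IH] [|k] //=; rewrite big_cons.
by have := IH k; lia.
Qed.

Lemma sumn_take_sorted s (k : nat) : sorted geq s ->
  exists c, (sumn (take k s) = k * c + \sum_(x <- s) (x - c))%N.
Proof.
have E0 c s' : all (fun x => x <= c)%N s' -> (\sum_(x <- s') (x - c) = 0)%N.
  by move=> /allP H; rewrite big_seq big1 // => x /H; lia.
elim: s k => [|x s IH] k sx.
  by exists 0%N; rewrite take_oversize // big_nil /= muln0.
have sx' : all (fun y => y <= x)%N s.
  by move: sx; rewrite /= path_sortedE 1?andbC; [case/andP|move=> a b c /=; lia].
case: k => [|k].
  exists x; rewrite take0 mul0n /= big_cons (E0 _ _ sx'); lia.
have [c Hc] := IH k (path_sorted sx).
have [le_cx|lt_xc] := leqP c x.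
  by exists c; rewrite /= big_cons Hc; lia.
(* All parts of the tail are at most x < c, so [Hc] says that its first k parts sum to k c, while
   the upper bound at threshold x gives at most k x. Hence k = 0, and x itself is a threshold. *)
exists x; rewrite /= big_cons (E0 _ _ sx'); move: Hc.
rewrite E0; last by apply: sub_all sx' => y; lia.
have : (sumn (take k s) <= k * x + \sum_(y <- s) (y - x))%N by exact: sumn_take_le_excess.
rewrite (E0 _ _ sx') => ? ?; nia.
Qed.

Lemma psum_geq_trans (N : nat) : transitive (psum_geq N).
Proof.
move=> t s u /forallP H1 /forallP H2; apply/forallP => k.
exact: leq_trans (H2 k) (H1 k).
Qed.

Lemma psum_geq_anti (N : nat) s t : size s = N -> size t = N ->
  psum_geq N s t -> psum_geq N t s -> s = t.
Proof.
move=> ss st /forallP H1 /forallP H2.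
have E k : (k <= N)%N -> sumn (take k s) = sumn (take k t).
  rewrite -ltnS => Hk; apply/eqP; rewrite eqn_leq.
  by rewrite (H1 (Ordinal Hk)) (H2 (Ordinal Hk)).
apply: (@eq_from_nth _ 0%N); first by rewrite ss st.
move=> i; rewrite ss => Hi; have := E i.+1 Hi; have := E i (ltnW Hi).
by rewrite !(take_nth 0%N) ?ss ?st // !sumn_rcons => -> /addnI.
Qed.

(** A partial sum of the larger sequence equals its bound at an optimal threshold c, and the other
    partial sum is at most its own bound at the same c. Excess sums ignore the order of the parts,
    so sorting drops out of the hypothesis. *)
Lemma dominates_sort (N : nat) s t : sumn s = sumn t ->
  (forall c, \sum_(x <- t) (x - c) <= \sum_(x <- s) (x - c))%N ->
  dominates N (decreasing s) (decreasing t).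
Proof.
move=> Est H; have P u : perm_eq (decreasing u) u by rewrite /decreasing perm_sort.
rewrite /dominates !sumnE !(perm_big _ (P _)) -!sumnE Est eqxx /=.
apply/forallP => k.
have [|c Hc] := @sumn_take_sorted (decreasing s) k.
  by apply: sort_sorted => a b; rewrite /= leq_total.
rewrite Hc; apply: leq_trans (sumn_take_le_excess _ _ c) _.
by rewrite !(perm_big _ (P _)) leq_add2l.
Qed.

End Dominance.

(** * The order on compositions *)

Section CompositionOrder.
Variable N : nat.
Implicit Types (g h k : 'X_{1..N}) (p q : 'I_N).

Lemma comp_gt_irr g : comp_gt g g = false.
Proof. by rewrite /comp_gt !eqxx. Qed.

Lemma comp_gt_mdeg g h : comp_gt g h -> mdeg g = mdeg h.
Proof. by case/and3P=> /eqP. Qed.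

Lemma size_decreasing g : size (decreasing g) = N.
Proof. by rewrite /decreasing size_sort size_tuple. Qed.

Lemma comp_gt_trans : transitive (@comp_gt N).
Proof.
have A := @psum_geq_anti N; have sD := size_decreasing.
move=> h g k /and3P[/eqP dgh ngh Hgh] /and3P[/eqP dhk nhk Hhk].
have dgk : mdeg g == mdeg k by rewrite dgh dhk.
case/orP: Hgh => /andP[Ngh Hgh]; case/orP: Hhk => /andP[Nhk Hhk].
- case/andP: (Hgh) => /eqP s1 D1; case/andP: (Hhk) => /eqP s2 D2.
  have Ngk : decreasing g != decreasing k.
    apply: contraNneq Ngh => Egk; apply/eqP/A; rewrite ?sD //.
    by rewrite Egk.
  rewrite /comp_gt dgk Ngk /dominates s1 s2 eqxx (psum_geq_trans D1 D2) /= andbT.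
  by apply: contraNneq Ngk => ->.
- rewrite /comp_gt dgk -(eqP Nhk) Ngh Hgh /= andbT.
  by apply: contraNneq Ngh => ->; rewrite (eqP Nhk).
- rewrite /comp_gt dgk (eqP Ngh) Nhk Hhk /= andbT.
  by apply: contraNneq Nhk => <-; rewrite (eqP Ngh).
- rewrite /comp_gt dgk (eqP Ngh) (eqP Nhk) eqxx (psum_geq_trans Hgh Hhk) /= andbT.
  apply: contraNneq ngh => Egk; rewrite -Egk in Hhk.
  by apply/eqP/val_inj/val_inj/A; rewrite ?size_tuple.
Qed.

Lemma mnm_seqE g : g = [seq g i | i <- enum 'I_N] :> seq nat.
Proof.
apply: (@eq_from_nth _ 0%N); first by rewrite size_tuple size_map size_enum_ord.
move=> i; rewrite size_tuple => Hi.
rewrite (nth_map (Ordinal Hi)) ?size_enum_ord // (mnm_nth 0%N) /=.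
by rewrite nth_enum_ord.
Qed.

Lemma sum_mnm (F : nat -> nat) g : (\sum_(x <- (g : seq nat)) F x = \sum_i F (g i))%N.
Proof. by rewrite {1}mnm_seqE big_map big_enum. Qed.

Lemma sumn_take_sum (s : seq nat) (k : nat) :
  sumn (take k s) = (\sum_(i < size s | i < k) nth 0 s i)%N.
Proof.
elim: s k => [|x s IH] k; first by rewrite big_ord0 take_oversize.
case: k => [|k]; first by rewrite take0 big_pred0.
by rewrite /= IH [RHS]big_mkcond big_ord_recl /= -big_mkcond.
Qed.

Lemma sumn_take_mnm g (k : nat) :
  sumn (take k g) = (\sum_(i < N | i < k) g i)%N.
Proof.
rewrite sumn_take_sum size_tuple; apply: eq_bigr => i _.
by rewrite (mnm_nth 0%N).
Qed.

Lemma sumn_mnm g : sumn g = mdeg g.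
Proof. by rewrite sumnE mdegE sum_mnm. Qed.

Lemma sum_move (F : nat -> nat) g h p q : p != q ->
  (forall i, i != p -> i != q -> h i = g i) ->
  (F (h p) + F (h q) + \sum_i F (g i) = F (g p) + F (g q) + \sum_i F (h i))%N.
Proof.
move=> npq H; have D k : (\sum_i F (k i)
  = F (k p) + (F (k q) + \sum_(i | (i != p) && (i != q)) F (k i)))%N.
  by rewrite (bigD1 p) // (bigD1 q) //= eq_sym.
rewrite !D.
have -> : (\sum_(i | (i != p) && (i != q)) F (h i)
  = \sum_(i | (i != p) && (i != q)) F (g i))%N.
  by apply: eq_bigr => i /andP[ip iq]; rewrite H.
lia.
Qed.

(** Moving two entries strictly towards each other with fixed sum cannot increase any excess sum, by
    convexity of x - c truncated at 0. It strictly lowers the sum of squares, so the rearrangements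
    differ. *)
Lemma comp_gt_squeeze g h p q : p != q ->
  (forall i, i != p -> i != q -> h i = g i) ->
  (h p + h q = g p + g q)%N ->
  (g p < h p)%N && (g p < h q)%N || (g q < h p)%N && (g q < h q)%N ->
  comp_gt g h.
Proof.
move=> npq H Es Hlt; have M F := sum_move F npq H.
have Ed : mdeg g = mdeg h by have := M id; rewrite !mdegE; lia.
have Nd : decreasing g != decreasing h.
  apply/negP=> /eqP; move/(congr1 (fun s => \sum_(x <- s) x ^ 2)%N).
  have P u : perm_eq (decreasing u) u by rewrite /decreasing perm_sort.
  rewrite !(perm_big _ (P _)) !sum_mnm; have := M (fun x => x ^ 2)%N.
  move: Hlt Es; nia.
rewrite /comp_gt Ed eqxx Nd /=; apply/andP; split.
  by apply: contraNneq Nd => ->.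
rewrite dominates_sort //; first by rewrite !sumn_mnm.
by move=> c; rewrite !sum_mnm; have := M (fun x => x - c)%N; lia.
Qed.

(** The rearrangement is unchanged; the partial sums over i < k drop by g_p - g_q for p < k <= q and
    stay the same for other k. *)
Lemma comp_gt_swap g p q : (p < q)%N -> (g q < g p)%N ->
  comp_gt g [multinom g (tperm p q i) | i < N].
Proof.
move=> pq gpq; set h := [multinom _ | _ < _].
have Ed : mdeg g = mdeg h by rewrite mdeg_mperm.
have hE i : h i = g (tperm p q i) by rewrite mnmE.
clearbody h.
have Eh : decreasing g = decreasing h.
  apply/perm_sortP; [by move=> a b /=; rewrite leq_total| | |].
  - by move=> a b c /=; lia.
  - by move=> a b /=; lia.
  rewrite [val (val g)]mnm_seqE [val (val h)]mnm_seqE.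
  have -> : [seq h i | i <- enum 'I_N]
    = [seq g i | i <- [seq tperm p q i | i <- enum 'I_N]].
    by rewrite -(map_comp (fun i => g i)); apply: eq_map => i; rewrite /= hE.
  apply: (perm_map (fun i => g i)); rewrite perm_sym.
  apply: uniq_perm; rewrite ?(map_inj_uniq perm_inj) ?enum_uniq // => j.
  by rewrite mem_enum -[j](tpermK p q) map_f ?mem_enum.
have ngh : g != h.
  apply/eqP => /mnmP /(_ p); rewrite hE tpermL => E; lia.
rewrite /comp_gt Ed Eh !eqxx ngh /=; apply/forallP => k.
have npq : p != q by rewrite neq_ltn pq.
have D (F : 'I_N -> nat) :
  (\sum_(i < N) F i = F p + (F q + \sum_(i < N | (i != p) && (i != q)) F i))%N.
  by rewrite (bigD1 p) // (bigD1 q) //= eq_sym.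
have M (g' : 'X_{1..N}) :
  sumn (take k g') = (\sum_(i < N) (if (i < k)%N then g' i else 0))%N.
  by rewrite sumn_take_mnm big_mkcond.
rewrite !M !D; rewrite !hE tpermL tpermR.
rewrite (eq_bigr (fun i : 'I_N => if (i < k)%N then g i else 0%N)).
  by rewrite !addnA leq_add2r; case: (ltnP p k); case: (ltnP q k); lia.
by move=> i /andP[ip iq]; rewrite hE tpermD // eq_sym.
Qed.

Lemma exists_maximal (s : seq 'X_{1..N}) : s != [::] ->
  exists2 g, g \in s & {in s, forall h, ~~ comp_gt h g}.
Proof.
elim: s => // x s IH _; have [->|/IH[g gs gmax]] := eqVneq s [::].
  by exists x; rewrite ?mem_head // => h; rewrite inE => /eqP ->; rewrite comp_gt_irr.
have [xg|nxg] := boolP (comp_gt x g).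
  exists x; rewrite ?mem_head // => h; rewrite inE => /orP[/eqP ->|hs].
    by rewrite comp_gt_irr.
  by apply: contra (gmax h hs) => hx; apply: comp_gt_trans hx xg.
exists g; first by rewrite inE gs orbT.
by move=> h; rewrite inE => /orP[/eqP ->|/gmax].
Qed.

End CompositionOrder.

(** * Triangularity and joint eigenvectors *)

Lemma card_ord_ltn (N k : nat) : (k <= N)%N -> #|[set i : 'I_N | (i < k)%N]| = k.
Proof.
move=> kN; have wI : injective (widen_ord kN) by move=> i j [/val_inj].
rewrite -[RHS]card_ord -(card_imset _ wI).
apply: eq_card => i; rewrite inE; apply/idP/imsetP => [ik|[j _ ->] /=].
  by exists (Ordinal ik) => //; apply: val_inj.
exact: ltn_ord.
Qed.

Lemma ord_neq_ltn (N : nat) (i j : 'I_N) : (i != j) = (i < j)%N || (j < i)%N.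
Proof. exact: neq_ltn. Qed.

Section Triangularity.
Variables (R : idomainType) (N : nat).
Implicit Types (i j p q : 'I_N) (f : {mpoly R[N]}) (g h k : 'X_{1..N}).

Local Notation mx := {mpoly R[N]}.

Definition comp_ge g h := (h == g) || comp_gt g h.

Lemma comp_ge_refl g : comp_ge g g. Proof. by rewrite /comp_ge eqxx. Qed.

Lemma comp_ge_trans g h k : comp_ge g h -> comp_ge h k -> comp_ge g k.
Proof.
rewrite /comp_ge; case/orP=> [/eqP -> //|gh] /orP[/eqP ->|hk].
  by rewrite gh orbT.
by rewrite (comp_gt_trans gh hk) orbT.
Qed.

(** All exponents lie on the segment from h to its swap. Interior points are squeezed; the swap
    itself occurs only if h_p > h_q, where it moves the larger entry to the right. *)
Lemma exchange_mon_support p q h k : (p < q)%N ->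
  (exchange_mon R p q h)@_k != 0 -> comp_ge h k.
Proof.
move=> pq; have npq : p != q by rewrite neq_ltn pq.
have nqp : q != p by rewrite eq_sym.
have S (n : nat) (F : nat -> 'X_{1..N}) : (\sum_(t < n) 'X_[F t] : mx)@_k != 0 ->
    exists2 t, (t < n)%N & k = F t.
  move=> nz; case: (pickP (fun t : 'I_n => k == F t)) => [t /eqP E|none].
    by exists t.
  move: nz; rewrite raddf_sum big1 ?eqxx //= => t _.
  by rewrite mcoeffX eq_sym none.
rewrite /exchange_mon; case: ltnP => hpq.
  case/(S _ (fun t => h + U_(p) *+ t - U_(q) *+ t)%MM)=> t ht E.
  case: t ht E => [|t] ht E.
    rewrite /comp_ge; apply/orP; left; apply/eqP; rewrite E.
    by apply/mnmP=> i; rewrite !(mnmE, mulmnE); lia.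
  apply/orP; right; apply: (comp_gt_squeeze npq); rewrite E.
  - move=> i ip iq; rewrite !(mnmE, mulmnE) (eq_sym p) (eq_sym q).
    by rewrite (negbTE ip) (negbTE iq); lia.
  - by rewrite !(mnmE, mulmnE) !eqxx (negbTE npq) (negbTE nqp); lia.
  - by rewrite !(mnmE, mulmnE) !eqxx (negbTE npq) (negbTE nqp); lia.
rewrite mcoeffN oppr_eq0.
case/(S _ (fun t => h + U_(q) *+ t.+1 - U_(p) *+ t.+1)%MM)=> t ht E.
apply/orP; right; have [Et|Et] := eqVneq t.+1 (h p - h q)%N.
  have -> : k = [multinom h (tperm p q i) | i < N].
    rewrite E; apply/mnmP=> i; rewrite !(mnmE, mulmnE).
    case: tpermP => [->|->|/eqP ip /eqP iq].
    - by rewrite !eqxx (negbTE nqp); lia.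
    - by rewrite !eqxx (negbTE npq); lia.
    - by rewrite (eq_sym p) (eq_sym q) (negbTE ip) (negbTE iq); lia.
  by apply: comp_gt_swap => //; lia.
apply: (comp_gt_squeeze npq); rewrite E.
- move=> i ip iq; rewrite !(mnmE, mulmnE) (eq_sym p) (eq_sym q).
  by rewrite (negbTE ip) (negbTE iq); lia.
- by rewrite !(mnmE, mulmnE) !eqxx (negbTE npq) (negbTE nqp); lia.
- by rewrite !(mnmE, mulmnE) !eqxx (negbTE npq) (negbTE nqp); lia.
Qed.

Lemma exchange_mon_diag p q h : (p < q)%N ->
  (exchange_mon R p q h)@_h = (h p < h q)%N%:R.
Proof.
move=> pq; have npq : p != q by rewrite neq_ltn pq.
have nqp : q != p by rewrite eq_sym.
rewrite /exchange_mon; case: ltnP => hpq.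
  have -> : (h q - h p = (h q - h p).-1.+1)%N by lia.
  rewrite big_ord_recl /= mcoeffD raddf_sum big1 ?addr0 /=.
    rewrite mcoeffX (_ : _ == h) //.
    by apply/eqP/mnmP=> i; rewrite !(mnmE, mulmnE); lia.
  move=> t _; rewrite mcoeffX; case: eqP => // /mnmP /(_ p).
  by rewrite !(mnmE, mulmnE) !eqxx (negbTE nqp) /bump => E; exfalso; lia.
rewrite mcoeffN raddf_sum big1 ?oppr0 //= => t _.
rewrite mcoeffX; case: eqP => // /mnmP /(_ q).
by rewrite !(mnmE, mulmnE) !eqxx (negbTE npq) => E; exfalso; lia.
Qed.

Lemma exchangeX i j h : exchange i j 'X_[h] =
  (if (i < j)%N then - exchange_mon R i j h
   else if (j < i)%N then exchange_mon R j i h else 0).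
Proof. by rewrite /exchange msuppX !big_seq1 mcoeffX eqxx !scale1r. Qed.

Lemma exchangeX_support i j h k :
  (exchange i j ('X_[h] : mx))@_k != 0 -> comp_ge h k.
Proof.
rewrite exchangeX; case: ltngtP => ij.
- by rewrite mcoeffN oppr_eq0; apply: exchange_mon_support.
- exact: exchange_mon_support.
- by rewrite mcoeff0 eqxx.
Qed.

Variable a : R.

(** The formula of [cherednik_eigenvalue] over any integral domain, so that it also makes sense over
    C[alpha]. *)
Definition spectrum h j : R :=
  a * (h j)%:R
  - #|[set i : 'I_N | (i < j)%N && (h j <= h i)%N]|%:R
  - #|[set i : 'I_N | (j < i)%N && (h j < h i)%N]|%:R.

Local Notation xi := (@cherednik_op R N a).

Lemma cherednik_opX_support j h k : (xi j 'X_[h])@_k != 0 -> comp_ge h k.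
Proof.
apply: contraNT => nhk; rewrite /cherednik_op /cherednik_main eulerX.
have X0 : 'X_[h]@_k = 0 :> R.
  by rewrite mcoeffX; case: eqP => // E; rewrite E comp_ge_refl in nhk.
rewrite !(mcoeffB, mcoeffD, mcoeffZ) X0 !mulr0 subr0 add0r raddf_sum big1 //= => i _.
by apply/eqP; apply: contraNT nhk; apply: exchangeX_support.
Qed.

Lemma cherednik_opX_diag j h : (xi j 'X_[h])@_h = spectrum h j.
Proof.
rewrite /cherednik_op /cherednik_main eulerX.
rewrite !(mcoeffB, mcoeffD, mcoeffZ) mcoeffX eqxx !mulr1 raddf_sum /=.
rewrite /spectrum -!addrA; congr (_ + _).
have card (P : pred 'I_N) : #|[set i | P i]|%:R = \sum_i (P i)%:R :> R.
  by rewrite cardsE -sum1_card natr_sum big_mkcond; apply: eq_bigr => i _;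
    rewrite unfold_in; case: (P i).
(* Spreading the scalar j over the indices i < j lets the diagonal entry be compared index by index:
   for i < j, the terms -1 and [h_i < h_j] combine to -[h_j <= h_i]. *)
have -> : j%:R = \sum_(i < N) (i < j)%N%:R :> R.
  rewrite -(card (fun i : 'I_N => (i < j)%N)); congr _%:R.
  by rewrite card_ord_ltn // ltnW.
rewrite !card -!sumrN -big_split big_mkcond -big_split; apply: eq_bigr => i _ /=.
rewrite exchangeX.
case: (ltngtP i j) => [ij|ij|/val_inj ->]; last by rewrite eqxx /= !oppr0 addr0.
- rewrite neq_ltn ij /= exchange_mon_diag // oppr0 addr0.
  by case: ltnP => _ /=; rewrite ?oppr0 ?subrr ?add0r.
- rewrite neq_ltn ij orbT /= mcoeffN exchange_mon_diag // oppr0 add0r addr0.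
  by [].
Qed.

Lemma mcoeff_cherednik_op j f k :
  (xi j f)@_k = \sum_(h <- msupp f) f@_h * (xi j 'X_[h])@_k.
Proof.
rewrite [in LHS](mpolyE f) linear_sum raddf_sum; apply: eq_bigr => h _ /=.
by rewrite linearZ mcoeffZ.
Qed.

Lemma cherednik_op_support j f k : (xi j f)@_k != 0 ->
  exists2 h, f@_h != 0 & comp_ge h k.
Proof.
move=> nz; case: (altP (@hasP _ (fun h => comp_ge h k) (msupp f))) => [[h hf hk]|none].
  by exists h; rewrite -?mcoeff_msupp.
move: nz; rewrite mcoeff_cherednik_op big_seq big1 ?eqxx // => h hf.
apply/eqP; rewrite mulf_eq0; apply/orP; right; apply: contraNT none => nz.
by apply/hasP; exists h => //; apply: cherednik_opX_support nz.
Qed.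

Lemma cherednik_op_lead j f k : (forall h, f@_h != 0 -> ~~ comp_gt h k) ->
  (xi j f)@_k = spectrum k j * f@_k.
Proof.
move=> top; rewrite mcoeff_cherednik_op.
have Z h : f@_h != 0 -> h != k -> (xi j 'X_[h])@_k = 0.
  move=> fh hk; apply/eqP; apply: contraNT (top h fh) => /cherednik_opX_support.
  by rewrite /comp_ge eq_sym (negbTE hk).
have [kf|kf] := boolP (k \in msupp f).
  rewrite (bigD1_seq k) ?msupp_uniq //= cherednik_opX_diag mulrC big_seq_cond.
  rewrite big1 ?addr0 // => h /andP[hf hk].
  by rewrite Z ?mulr0 -?mcoeff_msupp.
rewrite (memN_msupp_eq0 kf) mulr0 big_seq big1 // => h hf.
rewrite Z ?mulr0 -?mcoeff_msupp //; by apply: contraNneq kf => <-.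
Qed.

(** Each pair holds a composition to be removed and the index of the operator that removes it; the
    index is free, so that it can be chosen to separate the composition from [lam]. *)
Definition annihilate (s : seq ('X_{1..N} * 'I_N)) f : mx :=
  foldr (fun (c : 'X_{1..N} * 'I_N) (u : mx) =>
    xi c.2 u - spectrum c.1 c.2 *: u) f s.

Lemma annihilate_shiftC s j (d : R) f :
  annihilate s (xi j f - d *: f) = xi j (annihilate s f) - d *: annihilate s f.
Proof. by elim: s => //= c s ->; rewrite cherednik_op_shiftC. Qed.

(** Induction on the length of [s]: the factor of a maximal composition g acts first and kills the
    coefficient at g. By triangularity the result is supported on the other compositions, which are
    still closed downwards because g is maximal. *)
Lemma annihilate_eq0 (s : seq ('X_{1..N} * 'I_N)) f :
  {in unzip1 s, forall h k, comp_gt h k -> k \in unzip1 s} ->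
  {subset msupp f <= unzip1 s} ->
  annihilate s f = 0.
Proof.
have [n] := ubnP (size s); elim: n s f => // n IH s f sn low sub.
have [s0|sN0] := eqVneq (unzip1 s) [::].
  have -> : s = [::] by case: (s) s0.
  apply: msuppnil0; apply/nilP; rewrite /nilp -all_pred0; apply/allP => h /sub.
  by rewrite s0.
have [g gs gmax] := exists_maximal sN0.
case/mapP: gs => c cs Eg; move: sn low sub gmax.
case/splitPr: cs => s1 s2 sn low sub gmax.
have mem k : (k \in unzip1 (s1 ++ c :: s2)) = (k == g) || (k \in unzip1 (s1 ++ s2)).
  by rewrite /unzip1 !map_cat !mem_cat /= inE -Eg; case: eqP => //=; rewrite orbT.
(* Commutation moves the factor of g to the innermost place. *)
rewrite /annihilate foldr_cat /= -/(annihilate s2 f) -annihilate_shiftC -foldr_cat.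
apply: IH.
- by move: sn; rewrite !size_cat /= addnS.
- move=> h hs k hk; have : k \in unzip1 (s1 ++ c :: s2).
    by apply: low hk; rewrite mem hs orbT.
  rewrite mem => /orP[/eqP Ek|//].
  by have := gmax h; rewrite mem hs orbT -Ek hk => /(_ isT).
move=> k; rewrite mcoeff_msupp mcoeffB mcoeffZ => nz.
have kg : k != g.
  apply: contraNneq nz => ->; rewrite -Eg cherednik_op_lead ?subrr // => h fh.
  by apply: gmax; apply: sub; rewrite mcoeff_msupp.
have : k \in unzip1 (s1 ++ c :: s2).
  have [fk|fk] := eqVneq f@_k 0; last by apply: sub; rewrite mcoeff_msupp.
  move: nz; rewrite fk mulr0 subr0 => /cherednik_op_support[h].
  rewrite -mcoeff_msupp => /sub hs /orP[/eqP -> //|]; exact: low.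
by rewrite mem (negbTE kg).
Qed.

Lemma annihilate_support lam s f :
  (forall k, f@_k != 0 -> comp_ge lam k) ->
  forall k, (annihilate s f)@_k != 0 -> comp_ge lam k.
Proof.
move=> Hf; elim: s => //= c s IH k; rewrite mcoeffB mcoeffZ => nz.
have [E|/IH //] := eqVneq (annihilate s f)@_k 0.
move: nz; rewrite E mulr0 subr0 => /cherednik_op_support[h /IH lh].
exact: comp_ge_trans.
Qed.

Lemma annihilate_lead lam s f :
  (forall k, f@_k != 0 -> comp_ge lam k) ->
  (annihilate s f)@_lam
  = (\prod_(c <- s) (spectrum lam c.2 - spectrum c.1 c.2)) * f@_lam.
Proof.
move=> Hf; elim: s => [|c s IH] /=; first by rewrite big_nil mul1r.
rewrite big_cons mcoeffB mcoeffZ cherednik_op_lead ?IH -?mulrBl ?mulrA //.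
move=> h /(annihilate_support Hf) /orP[/eqP ->|lh]; first by rewrite comp_gt_irr.
by apply/negP => /(comp_gt_trans lh); rewrite comp_gt_irr.
Qed.

(** Subtracting the eigenvalue from xi_j cancels the leading term of x^lam and leaves only
    compositions strictly below [lam], all of which the product annihilates. *)
Lemma annihilate_eigen lam s j : 
  (forall k, (k \in unzip1 s) = comp_gt lam k) ->
  xi j (annihilate s 'X_[lam]) = spectrum lam j *: annihilate s 'X_[lam].
Proof.
move=> mem; apply/eqP; rewrite -subr_eq0 -annihilate_shiftC; apply/eqP.
apply: annihilate_eq0 => [g|h].
  by rewrite mem => lg h gh; rewrite mem; apply: comp_gt_trans lg gh.
rewrite mem mcoeff_msupp mcoeffB mcoeffZ => nz.
have hl : h != lam.
  apply: contraNneq nz => ->; rewrite cherednik_opX_diag mcoeffX eqxx mulr1.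
  by rewrite subrr.
move: nz; rewrite mcoeffX (eq_sym lam) (negbTE hl) mulr0 subr0 => /cherednik_opX_support.
by rewrite /comp_ge (negbTE hl).
Qed.

End Triangularity.

(** * Separation of the spectra *)

Section Separation.
Variable N : nat.
Implicit Types (i j : 'I_N) (g h : 'X_{1..N}).

(** The order of the indices in the stable decreasing rearrangement of g: larger entries first, ties
    by index. Thus [position] is the 0-based place of an index in g^+. *)
Definition before g : rel 'I_N := fun i j =>
  (i < j)%N && (g j <= g i)%N || (j < i)%N && (g j < g i)%N.

Definition position g j : nat := #|[set i | before g i j]|.

Lemma before_irr g i : before g i i = false.
Proof. by rewrite /before ltnn. Qed.

Lemma before_trans g : transitive (before g).
Proof.
move=> j i k; have [->|] := eqVneq i k; rewrite /before; first by lia.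
by rewrite ord_neq_ltn => /orP[]; lia.
Qed.

Lemma beforeN g i j : i != j -> before g j i = ~~ before g i j.
Proof. by rewrite ord_neq_ltn /before => /orP[] ?; lia. Qed.

Lemma before_le g i j : before g i j -> (g j <= g i)%N.
Proof. by rewrite /before; lia. Qed.

Lemma position_lt g i j : before g i j -> (position g i < position g j)%N.
Proof.
move=> ij; apply: proper_card; apply/properP; split.
  by apply/subsetP => k; rewrite !inE => /before_trans; apply.
by exists i; rewrite !inE ?before_irr.
Qed.

Lemma ltn_position g i j : (position g i < position g j)%N = before g i j.
Proof.
apply/idP/idP => [lt|/position_lt //]; have [E|nij] := eqVneq i j.
  by rewrite E ltnn in lt.
rewrite -[before g i j]negbK -beforeN //; apply/negP => /position_lt; lia.
Qed.

Lemma position_bound g i : (position g i < N)%N.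
Proof.
rewrite -[X in (_ < X)%N](card_ord N) -cardsT; apply: proper_card.
by apply/properP; split; [exact/subsetP|exists i; rewrite !inE ?before_irr].
Qed.

Lemma position_inj g : injective (position g).
Proof.
move=> i j E; apply/eqP; apply/negPn/negP => nij.
have := beforeN g nij; rewrite -!ltn_position E ltnn; by [].
Qed.

Lemma sum_position (F : nat -> int) g : \sum_i F (position g i) = \sum_(i < N) F i.
Proof.
pose p i := Ordinal (position_bound g i).
have pI : injective p by move=> i j /(congr1 val) /position_inj.
by rewrite [RHS](reindex_inj pI).
Qed.

Lemma position_sum g j : (position g j)%:Z = \sum_i (before g i j)%:Z.
Proof.
rewrite /position -sum1_card big_mkcond /=.
rewrite (big_morph Posz PoszD (erefl _)); apply: eq_bigr => i _.
by rewrite inE; case: (before g i j).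
Qed.

Section Compare.
Variables (lam gam : 'X_{1..N}) (s : nat).
Hypothesis s_odd : odd s.
Hypothesis gap : forall i j, before lam i j ->
  (lam j + s.+1 * (position lam j - position lam i) <= lam i + 1)%N.
Hypothesis same : forall i,
  (2 * lam i + s * position lam i = 2 * gam i + s * position gam i)%N.

Local Notation a := (position lam).
Local Notation b := (position gam).

(** Put d = a_j - a_i. Subtracting the two instances of [same] and using gam_i <= gam_j gives s (b_i
    - b_j) >= 2 (lam_i - lam_j) - s d, and [gap] bounds the right side below by s d + 2 (d - 1). *)
Lemma inversion_bound i j : before lam i j -> before gam j i ->
  (s * (a j - a i) + 2 * (a j - a i).-1 <= s * (b i - b j))%N.
Proof.
move=> lij gji; have := gap lij; have := before_le gji.
have := position_lt lij; have := position_lt gji; have := same i; have := same j.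
move: (a i) (a j) (b i) (b j) => ai aj bi bj Ej Ei bji aij gl lg.
have [d Ed] : exists d, aj = (ai + d.+1)%N by exists (aj - ai).-1; lia.
have [D ED] : exists D, bi = (bj + D)%N by exists (bi - bj)%N; lia.
move: Ej Ei lg; rewrite Ed ED !addKn !mulnDr !mulSn !mulnS /=; lia.
Qed.

Lemma inversion_expands i j : before lam i j -> before gam j i ->
  (a j + b j <= a i + b i)%N.
Proof.
move=> lij gji; have B := inversion_bound lij gji.
have s0 : (0 < s)%N by case: (s) s_odd.
have : (s * (a j - a i) <= s * (b i - b j))%N by apply: leq_trans B; apply: leq_addr.
by rewrite leq_pmul2l //; have := position_lt lij; have := position_lt gji; lia.
Qed.

Lemma inversion_tight i j : before lam i j -> before gam j i ->
  (a j + b j = a i + b i)%N -> a j = (a i).+1.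
Proof.
move=> lij gji E; have := inversion_bound lij gji.
have -> : (b i - b j = a j - a i)%N.
  by have := position_lt lij; have := position_lt gji; lia.
by have := position_lt lij; lia.
Qed.

(* Summing [a_i + b_i] against the identity [b_i - a_i = \sum_j e i j] over all
   [i] gives 0 because [a] and [b] are both permutations of [0 .. N-1]; as [e]
   is antisymmetric, the sum is half of the sum below, whose terms are
   nonnegative since inversions expand. *)
Lemma inversion_equality i j : before lam i j -> before gam j i ->
  (a j + b j = a i + b i)%N.
Proof.
move=> lij gji; pose e i j : int := (before gam j i)%:Z - (before lam j i)%:Z.
pose c i : int := (a i)%:Z + (b i)%:Z.
have eN i' j' : e j' i' = - e i' j'.
  rewrite /e; have [->|nij] := eqVneq i' j'; first by rewrite !before_irr subrr.
  by rewrite !(beforeN _ nij); case: (before lam _ _); case: (before gam _ _).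
have eS i' : \sum_j' e i' j' = (b i')%:Z - (a i')%:Z.
  by rewrite !position_sum -sumrB.
have S0 : \sum_i' \sum_j' c i' * e i' j' = 0.
  transitivity (\sum_i' ((b i')%:Z ^+ 2 - (a i')%:Z ^+ 2)).
    by apply: eq_bigr => i' _; rewrite -mulr_sumr eS /c; ring.
  by rewrite sumrB !(sum_position (fun x => x%:Z ^+ 2)) subrr.
have S1 : \sum_i' \sum_j' (c i' - c j') * e i' j' = 0.
  transitivity (\sum_i' \sum_j' c i' * e i' j' + \sum_i' \sum_j' c j' * e j' i').
    rewrite -big_split; apply: eq_bigr => i' _ /=; rewrite -big_split.
    by apply: eq_bigr => j' _; rewrite /= (eN i' j'); ring.
  by rewrite [X in _ + X]exchange_big /= S0.
have T0 i' j' : 0 <= (c i' - c j') * e i' j'.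
  rewrite /e; have [->|nij] := eqVneq i' j'; first by rewrite subrr mul0r.
  have := @inversion_expands i' j'; have := @inversion_expands j' i'.
  rewrite !(beforeN _ nij) /c.
  case: (before lam _ _); case: (before gam _ _) => //= H1 H2.
  - by rewrite subrr mulr0.
  - by have := H2 isT isT; lia.
  - by have := H1 isT isT; lia.
  - by rewrite subrr mulr0.
have R0 i' : 0 <= \sum_j' (c i' - c j') * e i' j' by apply: sumr_ge0.
have /eqP := S1; rewrite psumr_eq0 // => /allP /(_ i (mem_index_enum _)).
rewrite psumr_eq0 // => /allP /(_ j (mem_index_enum _)) /=.
have nij : i != j by apply: contraTneq lij => ->; rewrite before_irr.
rewrite /e gji (beforeN _ nij) lij /c; lia.
Qed.

Lemma position_same_odd i : odd (a i) = odd (b i).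
Proof.
by have := congr1 odd (same i); rewrite !mul2n !oddD !odd_double !oddM s_odd.
Qed.

(** An index before i in [gam] but not in [lam] forms a tight inversion with i, so its position in
    [lam] is a_i + 1; there is at most one, whence b_i <= a_i + 1. The other bound is symmetric, and
    parity excludes a difference of 1. *)
Lemma position_eq i : a i = b i.
Proof.
have card1 (P : pred nat) : (forall x y, P x -> P y -> x = y) ->
    (#|[set j : 'I_N | P (a j)]| <= 1)%N.
  move=> PU; apply/card_le1_eqP => x y; rewrite !inE => Px Py.
  by apply: (@position_inj lam); apply: PU.
have ba : (b i <= a i + 1)%N.
  apply: leq_trans (leq_add (leqnn _) (card1 (pred1 (a i).+1) _)); last first.
    by move=> x y /= /eqP -> /eqP ->.
  apply: leq_trans (leq_card_setU _ _); apply: subset_leq_card.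
  apply/subsetP => j; rewrite !inE => gji; have [//|nlji] := boolP (before lam j i).
  have nij : i != j by apply: contraTneq gji => ->; rewrite before_irr.
  have lij : before lam i j by move: nlji; rewrite (beforeN _ nij) negbK.
  by rewrite (inversion_tight lij gji (inversion_equality lij gji)) eqxx.
have ab : (a i <= b i + 1)%N.
  apply: leq_trans (leq_add (leqnn _) (card1 (fun x => x.+1 == a i) _)); last first.
    by move=> x y /eqP <- /eqP [].
  apply: leq_trans (leq_card_setU _ _); apply: subset_leq_card.
  apply/subsetP => j; rewrite !inE => lji; have [//|ngji] := boolP (before gam j i).
  have nij : i != j by apply: contraTneq lji => ->; rewrite before_irr.
  have gij : before gam i j by move: ngji; rewrite (beforeN _ nij) negbK.
  by rewrite (inversion_tight lji gij (inversion_equality lji gij)) eqxx.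
have := position_same_odd i; move: ba ab; move: (a i) (b i) => x y; lia.
Qed.

Lemma composition_eq : lam = gam.
Proof. by apply/mnmP=> i; have := same i; rewrite position_eq; lia. Qed.

End Compare.

Lemma card_ltn_inj (p : 'I_N -> 'I_N) i : injective p ->
  #|[set j | (p j < p i)%N]| = p i.
Proof.
move=> pI; rewrite -[RHS](@card_ord_ltn N) 1?ltnW //.
rewrite -(card_imset _ pI); apply: eq_card => j; rewrite inE.
have [q pK qK] := injF_bij pI.
apply/imsetP/idP => [[k + ->]|jp]; first by rewrite inE.
by exists (q j); rewrite ?inE qK.
Qed.

(** Admissibility spaces the sorted values of c_i = lam_i + [i < m] by at least r >= 2. As the shift
    is at most 1, sorting by c orders the indices exactly as [before lam] does, and removing the
    shift costs the final + 1. *)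
Lemma admissible_gap (r m : nat) lam : (1 < r)%N -> moderately_admissible r m lam ->
  forall i j, before lam i j ->
  (lam j + r * (position lam j - position lam i) <= lam i + 1)%N.
Proof.
move=> r2 adm; pose c i := (lam i + (i < m))%N.
pose L := decreasing [seq c i | i : 'I_N].
have step l : (l.+1 < N)%N -> (nth 0 L l.+1 + r <= nth 0 L l)%N by exact: adm.
have permL : perm_eq L [seq c i | i : 'I_N] by rewrite /L /decreasing perm_sort.
have sL : size L = N by rewrite (perm_size permL) size_map -cardE card_ord.
have gapL k l : (k <= l)%N -> (l < N)%N -> (nth 0 L l + r * (l - k) <= nth 0 L k)%N.
  elim: l => [|l IH]; first by rewrite leqn0 => /eqP ->; rewrite subnn muln0 addn0.
  rewrite leq_eqVlt => /orP[/eqP ->|kl] lN; first by rewrite subnn muln0 addn0.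
  by have := step l lN; have := IH kl (ltnW lN); rewrite subSn // mulnS; lia.
have cL i : c i \in L by rewrite (perm_mem permL) map_f // mem_enum.
have pN i : (index (c i) L < N)%N by rewrite -sL index_mem.
pose p i := Ordinal (pN i).
have pE i : nth 0%N L (p i) = c i by rewrite nth_index.
have gapc i j : (p i <= p j)%N -> (c j + r * (p j - p i) <= c i)%N.
  by move=> pij; have := gapL _ _ pij (ltn_ord (p j)); rewrite !pE.
have uL : uniq L.
  apply/(uniqP 0%N) => x y; rewrite !inE sL => xN yN E.
  wlog xy : x y xN yN E / (x <= y)%N.
    by move=> W; case/orP: (leq_total x y) => H; [|apply/esym]; apply: W.
  have := gapL _ _ xy yN; rewrite E -[leqRHS]addn0 leq_add2l leqn0 muln_eq0; lia.
have cI : injective c.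
  move: uL; rewrite (perm_uniq permL) => /injectiveP; exact.
have pI : injective p by move=> i j E; apply: cI; rewrite -!pE E.
have lt_before i j : (p i < p j)%N -> before lam i j.
  move=> pij; have := gapc _ _ (ltnW pij); rewrite /c /before.
  have : (r * 1 <= r * (p j - p i))%N by rewrite leq_mul2l; apply/orP; right; lia.
  have : i != j by apply: contraTneq pij => ->; rewrite ltnn.
  rewrite ord_neq_ltn; lia.
have beforeE i j : before lam i j = (p i < p j)%N.
  apply/idP/idP => [ij|/lt_before //]; rewrite ltnNge leq_eqVlt; apply/negP.
  case/orP => [/eqP /val_inj /pI E|/lt_before /(before_trans ij)].
    by rewrite E before_irr in ij.
  by rewrite before_irr.
have posE i : position lam i = p i.
  by rewrite -(card_ltn_inj i pI); apply: eq_card => j; rewrite !inE beforeE.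
move=> i j; rewrite beforeE !posE => /ltnW /gapc; rewrite /c; lia.
Qed.

End Separation.

(** * Change of the coefficient ring *)

Section BaseChange.
Variables (R S : idomainType) (psi : {rmorphism R -> S}) (N : nat).
Implicit Types (i j : 'I_N) (f : {mpoly R[N]}).

Local Notation map := (map_mpoly psi).

Lemma map_mpoly_euler i f : map (euler i f) = euler i (map f).
Proof.
apply/mpolyP=> h; rewrite mcoeff_map_mpoly !mcoeff_euler mcoeff_map_mpoly /=.
by rewrite (rmorphM psi) rmorph_nat.
Qed.

Lemma map_mpoly_msym (s : 'S_N) f : map (msym s f) = msym s (map f).
Proof. by apply/mpolyP=> h; rewrite mcoeff_map_mpoly !mcoeff_sym mcoeff_map_mpoly. Qed.

Lemma map_mpoly_exchange i j f : map (exchange i j f) = exchange i j (map f).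
Proof.
have [->|nij] := eqVneq i j; first by rewrite !exchangeii raddf0.
apply/esym/exchange_unique => //.
have := congr1 map (exchangeP i j f).
by rewrite !rmorphM !raddfB /= !map_mpolyX map_mpoly_msym.
Qed.

(** Applied to the evaluation of C[alpha] at a point and to its inclusion in the fraction field,
    this carries one eigenvector over C[alpha] to both settings. *)
Lemma map_mpoly_cherednik_op a j f :
  map (cherednik_op a j f) = cherednik_op (psi a) j (map f).
Proof.
rewrite /cherednik_op /cherednik_main !(raddfB, raddfD) /= !map_mpolyZ rmorph_nat.
rewrite map_mpoly_euler (raddf_sum (map_mpoly psi)); congr (_ + _ - _).
by apply: eq_bigr => i _; apply: map_mpoly_exchange.
Qed.

Lemma rmorph_spectrum a (h : 'X_{1..N}) j :
  psi (spectrum a h j) = spectrum (psi a) h j.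
Proof. by rewrite /spectrum !rmorphB rmorphM !rmorph_nat. Qed.

End BaseChange.

(** * The Jack conditions in terms of polynomial operators, and uniqueness *)

Section JackConditions.
Variables (F : fieldType) (N : nat) (a : F) (lam : 'X_{1..N}).
Implicit Types (E : {mpoly F[N]}).

Lemma tofrac_exchange (i j : 'I_N) E : i != j ->
  tofrac (exchange i j E) = tofrac 'X_(ordmax_of i j)
   / tofrac ('X_i - 'X_j) * tofrac (E - msym (tperm i j) E).
Proof.
move=> nij; rewrite mulrAC; apply: canRL (mulfK _) _.
  by rewrite tofrac_eq0 mpolyXB_neq0.
by rewrite mulrC -!tofracM exchangeP.
Qed.

(** Splitting the sum over i != j at i < j turns the numerator x_max into x_j and x_i, as in the
    rational form. *)
Lemma cherednikE j E : cherednik a j E = tofrac (cherednik_op a j E).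
Proof.
rewrite /cherednik /cherednik_op tofracB /cherednik_main tofracD raddf_sum /=.
congr (_ - _); rewrite -addrA; congr (_ + _).
rewrite [RHS](bigID (fun i : 'I_N => (i < j)%N)) /=; congr (_ + _).
  apply: eq_big => [i|i ij]; first by rewrite ord_neq_ltn; lia.
  have nji : j != i by rewrite ord_neq_ltn ij orbT.
  have M : ordmax_of j i = j by rewrite /ordmax_of ltnNge (ltnW ij).
  by have := tofrac_exchange E nji; rewrite M (tpermC j i) => <-.
apply: eq_big => [i|i ij]; first by rewrite ord_neq_ltn; lia.
have nji : j != i by rewrite ord_neq_ltn ij.
have M : ordmax_of j i = i by rewrite /ordmax_of ij.
by have := tofrac_exchange E nji; rewrite M (tpermC j i) => <-.
Qed.

Lemma triangularP E :
  triangular lam E <-> E@_lam = 1 /\ forall k, E@_k != 0 -> comp_ge lam k.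
Proof.
have coefS (c : 'X_{1..N} -> F) k :
  (\sum_(g : 'X_{1..N < (mdeg lam).+1} | comp_gt lam g) c g *: 'X_[g])@_k
  = if comp_gt lam k then c k else 0.
  rewrite raddf_sum /=; case: ifP => lk.
    have dk : (mdeg k < (mdeg lam).+1)%N by rewrite (comp_gt_mdeg lk).
    rewrite (bigD1 (BMultinom dk)) //= mcoeffZ mcoeffX eqxx mulr1.
    rewrite big1 ?addr0 // => g /andP[_ ng]; rewrite mcoeffZ mcoeffX.
    case: eqP => [E0|_]; rewrite ?mulr0 //.
    by case/negP: ng; apply/eqP/val_inj.
  rewrite big1 // => g lg; rewrite mcoeffZ mcoeffX.
  by case: eqP => [E0|_]; rewrite ?mulr0 //; rewrite E0 lk in lg.
split=> [[c ->]|[E1 Es]].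
  split; first by rewrite mcoeffD coefS comp_gt_irr mcoeffX eqxx addr0.
  move=> k; rewrite mcoeffD coefS mcoeffX /comp_ge (eq_sym k).
  by case: (eqVneq lam k) => // _; case: (comp_gt lam k) => //; rewrite addr0 eqxx.
exists (fun k => E@_k); apply/mpolyP => k.
rewrite mcoeffD (coefS (fun k => E@_k)) mcoeffX.
have [<-|nk] := eqVneq lam k; first by rewrite comp_gt_irr addr0 E1.
rewrite add0r; case: ifP => // lk; apply/eqP; apply: contraFT lk => /Es.
by rewrite /comp_ge (eq_sym k) (negbTE nk).
Qed.

Lemma jack_conditionsP E : jack_conditions a lam E <->
  [/\ E@_lam = 1, forall k, E@_k != 0 -> comp_ge lam k
    & forall j, cherednik_op a j E = spectrum a lam j *: E].
Proof.
split=> [[/triangularP[E1 Es] Ej]|[E1 Es Ej]].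
  split=> // j; apply/eqP; rewrite -tofrac_eq -cherednikE Ej; exact: eqxx.
split; first exact/triangularP.
by move=> j; rewrite cherednikE Ej.
Qed.

(** A maximal exponent g of a nonzero difference lies strictly below [lam], since the leading terms
    cancel. Comparing coefficients at g in the eigenvalue equations gives g the same spectrum as
    [lam], against separation. *)
Lemma jack_conditions_unique E E' :
  (forall g, comp_gt lam g -> exists j, spectrum a lam j != spectrum a g j) ->
  jack_conditions a lam E -> jack_conditions a lam E' -> E = E'.
Proof.
move=> sep /jack_conditionsP[E1 Es Ej] /jack_conditionsP[E1' Es' Ej'].
apply/eqP; rewrite -subr_eq0; apply/negPn/negP => nz.
have Dj j : cherednik_op a j (E - E') = spectrum a lam j *: (E - E').
  by rewrite raddfB /= Ej Ej' scalerBr.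
rewrite -msupp_eq0 in nz; have [g] := exists_maximal nz.
rewrite mcoeff_msupp => Dg gmax.
have lg : comp_gt lam g.
  have gl : g != lam by apply: contraNneq Dg => ->; rewrite mcoeffB E1 E1' subrr.
  have : comp_ge lam g.
    have [Eg|/Es //] := eqVneq E@_g 0; apply: Es'.
    by apply: contraNneq Dg => Eg'; rewrite mcoeffB Eg Eg' subrr.
  by rewrite /comp_ge (negbTE gl).
have [j /negP] := sep g lg; apply; apply/eqP; apply: (mulIf Dg).
rewrite -cherednik_op_lead ?Dj ?mcoeffZ // => h.
by rewrite -mcoeff_msupp => /gmax.
Qed.

End JackConditions.

(** * Existence, specialization and the theorem *)

Section Existence.
Variables (R : idomainType) (F : fieldType) (psi : {rmorphism R -> F}).
Variables (N : nat) (a : R) (lam : 'X_{1..N}) (s : seq ('X_{1..N} * 'I_N)).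
Hypothesis mem_s : forall k, (k \in unzip1 s) = comp_gt lam k.

Let P := annihilate a s 'X_[lam].

Lemma annihilateX_lead :
  P@_lam = \prod_(c <- s) (spectrum a lam c.2 - spectrum a c.1 c.2).
Proof.
rewrite annihilate_lead ?mcoeffX ?eqxx ?mulr1 // => k.
by rewrite mcoeffX /comp_ge (eq_sym k); case: (eqVneq lam k) => //; rewrite eqxx.
Qed.

(** Normalization is postponed until after [psi], so the same [P] over [R] serves for the generic
    and for the specialized polynomial. *)
Lemma jack_conditions_annihilate : psi P@_lam != 0 ->
  jack_conditions (psi a) lam ((psi P@_lam)^-1 *: map_mpoly psi P).
Proof.
move=> nz; apply/jack_conditionsP; split=> [|k|j].
- by rewrite mcoeffZ mcoeff_map_mpoly mulVf.
- rewrite mcoeffZ mcoeff_map_mpoly mulf_eq0 negb_or => /andP[_ Pk].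
  apply: (@annihilate_support _ _ a lam s 'X_[lam]); last first.
    by apply: contraNneq Pk => Pk0; rewrite /P Pk0 raddf0.
  by move=> h; rewrite mcoeffX /comp_ge (eq_sym h); case: (eqVneq lam h) => //; rewrite eqxx.
- rewrite linearZ /= -map_mpoly_cherednik_op annihilate_eigen // map_mpolyZ.
  by rewrite rmorph_spectrum scalerA mulrC -scalerA.
Qed.

End Existence.

Lemma spectrumE (R : idomainType) (N : nat) (a : R) (h : 'X_{1..N}) j :
  spectrum a h j = a * (h j)%:R - (position h j)%:R.
Proof.
rewrite /spectrum -addrA -opprD -natrD; congr (_ - _%:R); rewrite /position.
rewrite -cardsUI (_ : _ :&: _ = set0); last by apply/setP => i; rewrite !inE; lia.
by rewrite cards0 addn0; apply: eq_card => i; rewrite !inE.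
Qed.

Lemma spectrum_separates (C : numFieldType) (N r m : nat) (lam gam : 'X_{1..N}) :
  (2 <= r)%N -> ~~ odd r -> moderately_admissible r m lam -> comp_gt lam gam ->
  exists j, spectrum (alpha1 C r) lam j != spectrum (alpha1 C r) gam j.
Proof.
move=> r2 r_even adm lg; apply/existsP; apply: contraTT lg => /existsPn same.
suff -> : lam = gam by rewrite comp_gt_irr.
case: r r2 r_even adm same => // s s1 /=; rewrite negbK => s_odd adm same.
apply: (composition_eq s_odd); first exact: admissible_gap adm.
move=> i; have := same i; rewrite negbK !spectrumE /alpha1 -[s.+1]addn1 natrD addrK.
have s0 : s%:R != 0 :> C by rewrite pnatr_eq0; case: (s) s1.
(* With r = s + 1 and alpha = -2/s, multiplying by -s turns equal eigenvalues into 2 lam_i + s a_i =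
   2 gam_i + s b_i, which descends to natural numbers in characteristic 0. *)
move=> /eqP E; have := congr1 (fun x : C => - s%:R * x) E.
have K x y : - s%:R * (- 2%:R / s%:R * x - y) = 2 * x + s%:R * y :> C by field.
by rewrite !K -!natrM -!natrD => /eqP; rewrite eqr_nat => /eqP.
Qed.

Lemma jack_at_separated (C : fieldType) (N : nat) (a : C) (lam : 'X_{1..N}) :
  (forall g, comp_gt lam g -> exists j, spectrum a lam j != spectrum a g j) ->
  exists E : {mpoly C[N]}, jack_at a lam E /\ unique (jack_conditions a lam) E.
Proof.
move=> sep.
pose l : seq 'X_{1..N} := [seq bmnm g | g <- 
  [seq g : 'X_{1..N < (mdeg lam).+1} <- enum {: 'X_{1..N < (mdeg lam).+1}}
    | comp_gt lam g]].
have mem_l k : (k \in l) = comp_gt lam k.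
  apply/mapP/idP => [[g]|lk]; first by rewrite mem_filter => /andP[lg _] ->.
  have dk : (mdeg k < (mdeg lam).+1)%N by rewrite (comp_gt_mdeg lk).
  by exists (BMultinom dk); rewrite // mem_filter lk mem_enum.
(* Each composition below [lam] is paired with an index that separates it from [lam] at [a]. *)
have [s sl ss] : exists2 s, unzip1 s = l &
    {in s, forall c, spectrum a lam c.2 != spectrum a c.1 c.2}.
  have : {in l, forall g, comp_gt lam g} by move=> g; rewrite mem_l.
  elim: l {mem_l} => [|g l IH] Hl; first by exists [::].
  have [s <- Hs] : exists2 s, unzip1 s = l &
      {in s, forall c, spectrum a lam c.2 != spectrum a c.1 c.2}.
    by apply: IH => h hl; apply: Hl; rewrite inE hl orbT.
  have [j Hj] := sep g (Hl g (mem_head _ _)).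
  by exists ((g, j) :: s) => // c; rewrite inE => /orP[/eqP ->|/Hs].
have mem_s k : (k \in unzip1 s) = comp_gt lam k by rewrite sl mem_l.
pose P := annihilate ('X : {poly C}) s 'X_[lam].
pose ev : {rmorphism {poly C} -> C} := horner_eval a.
pose fr : {rmorphism {poly C} -> {fraction {poly C}}} := @tofrac {poly C}.
have evX : ev 'X = a by apply: hornerX.
(* The leading coefficient is a product of differences of eigenvalues, none of which vanishes at
   [a]; in particular it is a nonzero polynomial. *)
have Da : ev P@_lam != 0.
  rewrite annihilateX_lead // rmorph_prod prodf_seq_neq0; apply/allP => c cs /=.
  by rewrite (rmorphB ev) !(rmorph_spectrum ev) evX subr_eq0 ss.
have D0 : fr P@_lam != 0.
  by rewrite tofrac_eq0; apply: contraNneq Da => ->; rewrite rmorph0.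
exists ((ev P@_lam)^-1 *: map_mpoly ev P).
have cE := jack_conditions_annihilate mem_s Da; rewrite evX in cE.
have cG := jack_conditions_annihilate mem_s D0.
split; last by split=> // E' cE'; apply: jack_conditions_unique cE cE'.
exists ((fr P@_lam)^-1 *: map_mpoly fr P); split.
  split=> // G' cG'; apply: jack_conditions_unique cG cG' => g /sep[j Hj].
  (* Separation at [a] implies generic separation: spectra equal in C[alpha] would stay equal under
     evaluation. *)
  exists j; rewrite -!(rmorph_spectrum fr) tofrac_eq; apply: contraNneq Hj => Ej.
  by rewrite -evX -!(rmorph_spectrum ev) Ej.
(* Every coefficient of the generic polynomial has denominator [P@_lam], which is nonzero at [a]; so
   there is no pole. *)
move=> g; exists P@_g, P@_lam; split=> //.
  by rewrite mcoeffZ mcoeff_map_mpoly mulrC.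
by rewrite mcoeffZ mcoeff_map_mpoly mulrC.
Qed.

Theorem mainTheorem8 (R : realType) (r m n : nat)
    (eta : m.-tuple nat) (mu : n.-tuple nat) :
  (2 <= r)%N -> ~~ odd r ->
  sorted geq eta -> sorted geq mu ->
  let lam := concat_comp eta mu in
  let a := alpha1 R[i] r in
  moderately_admissible r m lam ->
  exists E : {mpoly R[i][m + n]},
    jack_at a lam E /\ unique (jack_conditions a lam) E.
Proof.
move=> r2 r_even _ _ lam a adm; apply: jack_at_separated => g.
exact: spectrum_separates adm.
Qed.
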